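(* Any infinite minimal subshift $X$ with $\limsup_{q\to\infty} p(q)/q<1.5$ is balanced on words.
   Context: A subshift is a closed shift-invariant subset $X\subset\mathcal{A}^{\mathbb{Z}}$ ($\mathcal{A}$ a finite alphabet); its language $\mathcal{L}(X)$ is the set of finite words appearing as subwords of points of $X$, and $p(q)$ is the number of words of length $q$ in $\mathcal{L}(X)$. For words $w,v$, $|w|$ is the length of $w$ and $|w|_v$ is the number of occurrences of $v$ as a subword of $w$. $X$ is balanced on words if for every $v\in\mathcal{L}(X)$ there is $C_v>0$ such that for all $w,w'\in\mathcal{L}(X)$ with $|w|=|w'|$, $\big||w|_v-|w'|_v\big|<C_v$. *)

(* Defs.v *)
From HB Require Import structures.
From mathcomp Require Import all_boot all_order all_algebra.
From mathcomp Require Import all_classical all_reals all_analysis.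

Set Implicit Arguments.
Unset Strict Implicit.
Unset Printing Implicit Defensive.

Import Order.TTheory GRing.Theory Num.Theory.
Import numFieldNormedType.Exports.

Local Open Scope classical_set_scope.
Local Open Scope ring_scope.

(* A^Z with the product of the discrete topologies. *)
Notation full_shift A := {ptws int -> discrete_topology A}.

Definition shift (A : finType) (x : full_shift A) : full_shift A :=
  fun n : int => x (n + 1).

(* Invariance is sigma(X) = X, the shift being a bijection of A^Z. *)
Definition subshift (A : finType) (X : set (full_shift A)) : Prop :=
  closed X /\ @shift A @` X = X.

Definition minimal_subshift (A : finType) (X : set (full_shift A)) : Prop :=
  [/\ subshift X, X !=set0 &
      forall Y : set (full_shift A),
        subshift Y -> Y !=set0 -> Y `<=` X -> Y = X].

Definition subword (A : finType) (x : full_shift A) (i : int) (q : nat) : seq A :=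
  mkseq (fun k : nat => x (i + k%:Z)) q.

Definition language (A : finType) (X : set (full_shift A)) : set (seq A) :=
  [set w | exists2 x, X x & exists i : int, w = subword x i (size w)].

Definition complexity (A : finType) (X : set (full_shift A)) (q : nat) : nat :=
  #|[set w : q.-tuple A | `[< language X w >]]%SET|.

(* Overlapping occurrences are counted separately. *)
Definition occurrences (A : finType) (v w : seq A) : nat :=
  count (fun i => prefix v (drop i w)) (iota 0 (size w).+1).

Definition balanced_on_words (A : finType) (X : set (full_shift A)) : Prop :=
  forall v, language X v ->
    exists2 C : int, 0 < C &
      forall w w', language X w -> language X w' -> size w = size w' ->
        `|(occurrences v w)%:Z - (occurrences v w')%:Z| < C.

(* Main.v *)
(* For a language with p(q) <= (3/2 - eps) q for large q, choose a length q
   where p increases by 1: there is a single right special word, with two return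
   words. Extending it to the left until it is bispecial gives a word W and two
   blocks B0, B1 such that, after W, every word of X is uniquely a concatenation
   of blocks. The complexity bound forbids right special words of both shapes
   ...B0 B1^m and ...B1 B0^m (m > 0), so that one block r only occurs, between
   two occurrences of the other block o, in runs of length 0 or D; hence
   (W, {r, o}) can be replaced by (W o, {o, r^D o}).

   Write a = |r|, b = |o|, e = |B0| + |B1| - |W|. A step replaces e by
   e + (D - 1) a, and p(q + 1) >= q + e holds for suitable q, so that for D >= 2
   the complexity bound yields b >= 3 e + (D - 2) a with some room to spare.
   Consequently min(3 e, 2 a, 2 b) is multiplied by more than (1 + gamma) D in
   each step with D >= 2 and does not decrease when D = 1.

   Let n0, n1 be the numbers of occurrences of v ending in B0 and B1.
   The determinant n0 |B1| - n1 |B0| is multiplied by -D in each step. If rho lies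
   between n0/|B0| and n1/|B1| at every level, the deviations n - rho |B| of the
   two blocks have opposite signs and are bounded by the determinant divided by
   the block lengths, so they decrease geometrically along the steps with
   D >= 2, and along the steps with D = 1 the errors made when a word is read in
   the new blocks telescope. Their sum bounds the deviation of every word. *)

Require Import Defs.
From HB Require Import structures.
From mathcomp Require Import all_boot all_order all_algebra.
From mathcomp Require Import all_classical all_reals all_analysis.
From mathcomp Require Import zify ring lra.

Set Implicit Arguments.
Unset Strict Implicit.
Unset Printing Implicit Defensive.

Import Order.TTheory GRing.Theory Num.Theory.
Import numFieldNormedType.Exports.

Local Open Scope nat_scope.

(** * Words and languages *)

Section Words.
Context (T : eqType).
Implicit Types (u v w x y z : seq T).

Definition prefix_cmp u v := prefix u v || prefix v u.
Definition suffix_cmp u v := suffix u v || suffix v u.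

Lemma prefix_leq_total u v w :
  prefix u w -> prefix v w -> size u <= size v -> prefix u v.
Proof.
move=> /prefixP[x ->] /prefixP[y e] le_uv; apply/prefixP.
exists (take (size v - size u) x); symmetry.
by have := congr1 (take (size v)) e; rewrite [RHS]take_size_cat // take_cat ltnNge le_uv.
Qed.

Lemma suffix_leq_total u v w :
  suffix u w -> suffix v w -> size u <= size v -> suffix u v.
Proof.
rewrite -!prefix_rev => uw vw le_uv; apply: prefix_leq_total uw vw _.
by rewrite !size_rev.
Qed.

Lemma prefix_total u v w : prefix u w -> prefix v w -> prefix_cmp u v.
Proof.
move=> uw vw; apply/orP; have [le_uv|/ltnW le_uv] := leqP (size u) (size v).
  by left; exact: prefix_leq_total uw vw le_uv.
by right; exact: prefix_leq_total vw uw le_uv.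
Qed.

Lemma suffix_total u v w : suffix u w -> suffix v w -> suffix_cmp u v.
Proof.
move=> uw vw; apply/orP; have [le_uv|/ltnW le_uv] := leqP (size u) (size v).
  by left; exact: suffix_leq_total uw vw le_uv.
by right; exact: suffix_leq_total vw uw le_uv.
Qed.

Lemma prefix_eq_size u v : prefix u v -> size v <= size u -> u = v.
Proof.
by move=> /prefixP[x ->]; rewrite size_cat -{2}[size u]addn0 leq_add2l leqn0
  => /nilP ->; rewrite cats0.
Qed.

(** In the third case [w] is the longest common suffix; this is how [W] arises from the two return
    words in [return_base]. *)
Lemma suffix_or_diverge u v :
  [\/ suffix u v, suffix v u |
      exists x y a b w, [/\ a != b, u = x ++ a :: w & v = y ++ b :: w]].
Proof.
elim/last_ind: u v => [|u a IHu] v; first by constructor 1; apply: suffix0s.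
case/lastP: v => [|v b]; first by constructor 2; apply: suffix0s.
have [<-|neq_ab] := eqVneq a b; last first.
  by constructor 3; exists u, v, a, b, [::]; rewrite -!cats1.
have [uv|vu|[x [y [c [d [w [neq_cd -> ->]]]]]]] := IHu v.
- by constructor 1; move: uv => /suffixP[x ->]; rewrite rcons_cat suffix_suffix.
- by constructor 2; move: vu => /suffixP[x ->]; rewrite rcons_cat suffix_suffix.
- by constructor 3; exists x, y, c, d, (rcons w a); rewrite !rcons_cat /=.
Qed.

(** A common suffix longer than [w] would end with both [a :: w] and [b :: w]. *)
Lemma diverging_suffix x y a b w u :
  a != b -> suffix u (x ++ a :: w) -> suffix u (y ++ b :: w) -> suffix u w.
Proof.
move=> neq_ab ux uy; have wx : suffix w (x ++ a :: w).
  by apply/suffixP; exists (rcons x a); rewrite cat_rcons.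
case: (leqP (size u) (size w)) => [le_uw|lt_wu].
  exact: suffix_leq_total ux wx le_uw.
have awu : suffix (a :: w) u by apply: suffix_leq_total (suffix_suffix _ _) ux _.
have bwu : suffix (b :: w) u by apply: suffix_leq_total (suffix_suffix _ _) uy _.
have := suffix_leq_total awu bwu (leqnn _).
rewrite suffixE /= subnn drop0 => /eqP[eq_ab].
by rewrite eq_ab eqxx in neq_ab.
Qed.

(* If [size w >= size u + size v], then [w] has both [size u] and [size v] as
   periods, so the letters preceding its two occurrences agree. *)
Lemma two_periods w u v x y a b :
  a != b -> w ++ u = x ++ a :: w -> w ++ v = y ++ b :: w ->
  size w < size u + size v.
Proof.
move=> neq_ab eu ev; rewrite ltnNge; apply/negP => le_uvw.
have su : size u = (size x).+1.
  by have := congr1 size eu; rewrite !size_cat /=; lia.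
have sv : size v = (size y).+1.
  by have := congr1 size ev; rewrite !size_cat /=; lia.
have pu i : i + size u < size w -> nth a w i = nth a w (i + size u).
  move=> lt_i; have := congr1 (fun s => nth a s (i + size u)) eu.
  rewrite nth_cat lt_i nth_cat su ltnNge -su.
  rewrite (_ : size x <= i + size u = true); last by lia.
  by rewrite (_ : i + size u - size x = i.+1) /=; [|lia].
have pv i : i + size v < size w -> nth a w i = nth a w (i + size v).
  move=> lt_i; have := congr1 (fun s => nth a s (i + size v)) ev.
  rewrite nth_cat lt_i nth_cat sv ltnNge -sv.
  rewrite (_ : size y <= i + size v = true); last by lia.
  by rewrite (_ : i + size v - size y = i.+1) /=; [|lia].
have ea : nth a w (size x) = a.
  have := congr1 (fun s => nth a s (size x)) eu.
  by rewrite !nth_cat ltnn subnn (_ : size x < size w = true) //; lia.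
have eb : nth a w (size y) = b.
  have := congr1 (fun s => nth a s (size y)) ev.
  by rewrite !nth_cat ltnn subnn (_ : size y < size w = true) //; lia.
(* Moving [size x] by the period [size v], and [size y] by the period [size u], leads to the same
   position of [w]. *)
move: neq_ab; rewrite -ea -eb pv ?(pu (size y)); try lia.
by rewrite (_ : size x + size v = size y + size u) ?eqxx //; lia.
Qed.

End Words.

Lemma run_split (r : bool) (v : seq bool) :
  v = nseq (size v) r \/ exists j v', v = nseq j r ++ (~~ r) :: v'.
Proof.
elim: v => [|c v [->|[j [v' ->]]]]; first by left.
  have [->|] := eqVneq c r; first by left; rewrite /= size_nseq.
  move=> ne; right; exists 0, (nseq (size v) r).
  by case: c r ne => [] [].
have [->|ne] := eqVneq c r; first by right; exists j.+1, v'.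
right; exists 0, (nseq j r ++ (~~ r) :: v').
by case: c r ne => [] [].
Qed.

Lemma run_split_r (r : bool) (v : seq bool) :
  v = nseq (size v) r \/ exists j v', v = v' ++ (~~ r) :: nseq j r.
Proof.
have [e|[j [v' e]]] := run_split r (rev v).
  by left; rewrite -[v]revK e rev_nseq size_nseq size_rev.
right; exists j, (rev v'); rewrite -[v]revK e rev_cat rev_nseq rev_cons.
by rewrite cat_rcons.
Qed.

(** * Languages, right special words and the growth of the complexity *)

Section Languages.
Context (A : finType) (L : seq A -> Prop).
Implicit Types (a b c : A) (u v w z W : seq A).

Definition right_special z :=
  exists a b, [/\ a != b, L (rcons z a) & L (rcons z b)].

(** What the argument uses of the language of an infinite minimal subshift: [lang_rec] expresses
    minimality and [lang_special] infinity. *)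
Record recurrent_language : Prop := RecurrentLanguage {
  lang_infix : forall u v w, L (u ++ v ++ w) -> L v;
  lang_right : forall u, L u -> exists a, L (rcons u a);
  lang_left : forall u, L u -> exists a, L (a :: u);
  lang_rec : forall v, L v ->
    exists N, forall u, L u -> N <= size u -> infix v u;
  lang_special : forall q, exists2 z, size z = q & right_special z }.

Definition nwords q := #|[set w : q.-tuple A | `[< L w >]]|.
Definition nspecial q := #|[set z : q.-tuple A | `[< right_special z >]]|.

Definition nspecial_off W q :=
  #|[set z : q.-tuple A | `[< right_special z >] && ~~ suffix_cmp z W]|.

Lemma seq_tuple q z : size z = q -> exists t : q.-tuple A, t = z :> seq A.
Proof. by move=> /eqP sz; exists (Tuple sz). Qed.

Section Counting.
Context (HL : recurrent_language).

Lemma lang_prefix u v : L (u ++ v) -> L u.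
Proof. exact: (@lang_infix HL [::]). Qed.

Lemma lang_suffix u v : L (u ++ v) -> L v.
Proof. by move=> Luv; apply: (@lang_infix HL u v [::]); rewrite cats0. Qed.

Lemma lang_rightn n u : L u -> exists2 s, size s = n & L (u ++ s).
Proof.
move=> Lu; elim: n => [|n [s <- Ls]]; first by exists [::]; rewrite ?cats0.
have [a La] := lang_right HL Ls.
by exists (rcons s a); rewrite ?size_rcons // -rcons_cat.
Qed.

Lemma lang_leftn n u : L u -> exists2 s, size s = n & L (s ++ u).
Proof.
move=> Lu; elim: n => [|n [s <- Ls]]; first by exists [::].
by have [a La] := lang_left HL Ls; exists (a :: s).
Qed.

Lemma right_special_suffix u v : suffix u v -> right_special v -> right_special u.
Proof.
move=> /suffixP[x ->] [a [b [ab La Lb]]]; exists a, b; split=> //.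
  by apply: (@lang_suffix x); rewrite -rcons_cat.
by apply: (@lang_suffix x); rewrite -rcons_cat.
Qed.

Lemma size_take_tuple q (t : q.+1.-tuple A) : size (take q t) == q.
Proof. by rewrite size_take size_tuple ltnSn. Qed.

(** Truncation to length [q] still maps the words of [L] outside [T] onto all words of length
    [q]. *)
Lemma nwords_add q (T : {set q.+1.-tuple A}) :
  (forall t, t \in T -> L t) ->
  (forall t, t \in T -> exists t' : q.+1.-tuple A,
      [/\ L t', t' \notin T & take q t' = take q t]) ->
  nwords q + #|T| <= nwords q.+1.
Proof.
move=> TL Tother; pose tk t : q.-tuple A := Tuple (size_take_tuple t).
set X := [set w : q.+1.-tuple A | `[< L w >]].
have TX : T \subset X by apply/fintype.subsetP => t /TL Lt; rewrite finset.inE; apply/asboolP.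
suff le_q : nwords q <= #|X :\: T|.
  have -> : nwords q.+1 = #|X| by [].
  by rewrite -(cardsID T X) (finset.setIidPr TX) addnC leq_add2l.
apply: leq_trans (leq_imset_card tk _); apply: subset_leq_card.
apply/fintype.subsetP => w; rewrite finset.inE => /asboolP Lw.
have [a La] := lang_right HL Lw.
have [t et] : exists t : q.+1.-tuple A, t = rcons w a :> seq A.
  by apply: seq_tuple; rewrite size_rcons size_tuple.
have tkt : take q t = w by rewrite et -cats1 take_size_cat ?size_tuple.
have [t' [Lt' nt' tkt']] : exists t' : q.+1.-tuple A,
    [/\ L t', t' \notin T & take q t' = w].
  have [tT|tT] := boolP (t \in T); last by exists t; split=> //; rewrite et.
  by have [t' []] := Tother t tT; rewrite tkt; exists t'.
apply/imsetP; exists t'; last by apply: val_inj; rewrite /= tkt'.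
by rewrite !finset.inE nt'; apply/asboolP.
Qed.

(** [T] takes one extension of each right special word; another extension of the same word stays
    outside [T]. *)
Lemma nwords_special q : nwords q + nspecial q <= nwords q.+1.
Proof.
pose first z := [pick a | `[< L (rcons z a) >]].
pose T := [set t : q.+1.-tuple A | `[< exists z a,
  [/\ t = rcons z a :> seq A, right_special z & first z = Some a] >]].
have firstL z a : first z = Some a -> L (rcons z a).
  by rewrite /first; case: pickP => // b /asboolP Lb [<-].
apply: leq_trans (nwords_add (T := T) _ _).
- rewrite leq_add2l; pose tk t : q.-tuple A := Tuple (size_take_tuple t).
  apply: leq_trans (leq_imset_card tk _); apply: subset_leq_card.
  apply/fintype.subsetP => z; rewrite finset.inE => /asboolP RSz.
  have [a fa] : exists a, first z = Some a.
    rewrite /first; case: pickP => [a _|no]; first by exists a.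
    by case: RSz => a [_ [_ La _]]; have /asboolP := no a.
  have [t et] : exists t : q.+1.-tuple A, t = rcons z a :> seq A.
    by apply: seq_tuple; rewrite size_rcons size_tuple.
  apply/imsetP; exists t; last first.
    by apply: val_inj; rewrite /= et -cats1 take_size_cat ?size_tuple.
  by rewrite finset.inE; apply/asboolP; exists z, a.
- by move=> t; rewrite finset.inE => /asboolP[z [a [-> _ /firstL]]].
- move=> t; rewrite finset.inE => /asboolP[z [a [et [b [c [bc Lb Lc]]] fa]]].
  have sz : size z = q by have := size_tuple t; rewrite et size_rcons => -[].
  have [d [da Ld]] : exists d, d != a /\ L (rcons z d).
    have [eba|] := eqVneq b a; last by exists b.
    by exists c; split=> //; rewrite -eba eq_sym.
  have [t' et'] : exists t' : q.+1.-tuple A, t' = rcons z d :> seq A.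
    by apply: seq_tuple; rewrite size_rcons sz.
  exists t'; split; first by rewrite et'.
    rewrite finset.inE; apply/asboolP => -[z' [d' [ed _ fd]]].
    have /rcons_inj[ez edd] : rcons z d = rcons z' d' by rewrite -et' -ed.
    move: fd da; rewrite -ez -edd fa => -[->]; by rewrite eqxx.
  by rewrite et et' -!cats1 !take_size_cat.
Qed.

Lemma nwords_three q z a b c : size z = q -> uniq [:: a; b; c] ->
  L (rcons z a) -> L (rcons z b) -> L (rcons z c) -> nwords q + 2 <= nwords q.+1.
Proof.
move=> sz; rewrite /= !finset.inE negb_or andbT => /andP[/andP[ab ac] bc] La Lb Lc.
have ext d : exists t : q.+1.-tuple A, t = rcons z d :> seq A.
  by apply: seq_tuple; rewrite size_rcons sz.
have [[[ta ea] [tb eb]] [tc ec]] := (ext a, ext b, ext c).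
have neq d e (td te : q.+1.-tuple A) : d != e ->
    td = rcons z d :> seq A -> te = rcons z e :> seq A -> td != te.
  move=> de ed ee; apply: contraNneq de => ete.
  by move: ed; rewrite ete ee => /rcons_inj[->].
have := nwords_add (T := [set tb; tc]); rewrite cards2 (neq b c) //; apply.
  by move=> t; rewrite !finset.inE => /orP[] /eqP ->; rewrite ?eb ?ec.
move=> t tT; exists ta; split; rewrite ?ea //.
  by rewrite !finset.inE negb_or (neq a b) //= (neq a c).
by move: tT; rewrite !finset.inE => /orP[] /eqP ->; rewrite ?eb ?ec -!cats1 !take_size_cat.
Qed.

Lemma nwords_sum Q q : Q <= q ->
  nwords Q + \sum_(Q <= i < q) nspecial i <= nwords q.
Proof.
move=> /subnKC <-; elim: (q - Q) => [|n IHn]; first by rewrite addn0 big_geq ?addn0.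
rewrite addnS big_nat_recr ?leq_addr //= addnA.
by apply: leq_trans (nwords_special _); rewrite leq_add2r.
Qed.

End Counting.

Lemma nspecial_off_leq W W' q : suffix W W' -> nspecial_off W q <= nspecial_off W' q.
Proof.
move=> WW'; apply: subset_leq_card; apply/fintype.subsetP => z; rewrite !finset.inE.
move=> /andP[-> /=]; apply: contra => /orP[zW'|W'z].
  exact: suffix_total zW' WW'.
by apply/orP; right; apply: suffix_trans WW' W'z.
Qed.

Lemma nspecial_off_lt W W' q z : suffix W W' -> size z = q -> right_special z ->
  suffix_cmp z W -> ~~ suffix_cmp z W' -> nspecial_off W q < nspecial_off W' q.
Proof.
move=> WW' /seq_tuple[t <-] RSz zW zW'; apply: proper_card; apply/properP; split.
  apply/fintype.subsetP => y; rewrite !finset.inE => /andP[-> /=].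
  apply: contra => /orP[yW'|W'y].
    exact: suffix_total yW' WW'.
  by apply/orP; right; apply: suffix_trans WW' W'y.
exists t; rewrite !finset.inE ?zW ?andbF // zW' andbT; exact/asboolP.
Qed.

Lemma nspecial_gt W q z : size z = q -> right_special z -> suffix_cmp z W ->
  nspecial_off W q < nspecial q.
Proof.
move=> /seq_tuple[t <-] RSz zW; apply: proper_card; apply/properP; split.
  by apply/fintype.subsetP => y; rewrite !finset.inE => /andP[].
by exists t; rewrite !finset.inE ?zW ?andbF //; apply/asboolP.
Qed.

Lemma nspecial_gt1 W q z z' : size z = q -> size z' = q -> z != z' ->
  right_special z -> right_special z' -> suffix_cmp z W -> suffix_cmp z' W ->
  nspecial_off W q + 2 <= nspecial q.
Proof.
move=> /seq_tuple[t <-] /seq_tuple[t' <-] tt' RSz RSz' zW zW'.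
pose X := [set y : q.-tuple A | `[< right_special y >] && ~~ suffix_cmp y W].
have -> : nspecial_off W q = #|X| by [].
have tt : t != t' by apply: contraNneq tt' => ->.
have <- : #|[set t; t']| = 2 by rewrite cards2 tt.
have dis : [disjoint X & [set t; t']].
  rewrite finset.disjoints_subset; apply/fintype.subsetP => y; rewrite !finset.inE => /andP[_].
  by apply: contra => /orP[] /eqP ->.
move: dis; rewrite -(leq_card_setU X [set t; t']).2 => /eqP <-.
apply: subset_leq_card; apply/fintype.subsetP => y; rewrite !finset.inE.
by case/orP=> [/andP[]|/orP[] /eqP ->] //; apply/asboolP.
Qed.

End Languages.

(** * Codings by two blocks *)

Section Coding.
Context (A : finType) (L : seq A -> Prop) (HL : recurrent_language L).
Implicit Types (a b : A) (c d r : bool) (u v : seq bool) (w z W : seq A)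
  (B : bool -> seq A).

(** A high power of [t] would contain both extensions of a right special word [v] of length
    [size t], but the period [size t] forces the letter after [v] to be its first letter. *)
Lemma lang_aperiodic t : t <> [::] -> exists N, ~ L (flatten (nseq N t)).
Proof.
move=> t0; have t_gt0 : 0 < size t by case: t t0.
have [v sv [a [b [ab La Lb]]]] := lang_special HL (size t).
have [Na HNa] := lang_rec HL La; have [Nb HNb] := lang_rec HL Lb.
exists (maxn Na Nb) => LU; set U := flatten _ in LU.
have sU : maxn Na Nb <= size U.
  rewrite size_flatten /shape map_nseq sumn_nseq.
  by rewrite -[X in X <= _]mul1n leq_mul2r t_gt0 orbT.
have comm : t ++ U = U ++ t.
  rewrite /U; elim: (maxn Na Nb) => [|n IHn] /=; first by rewrite cats0.
  by rewrite -catA -IHn.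
have per i : i + size t < size U -> nth a U i = nth a U (i + size t).
  move=> lt_i; have := congr1 (fun s => nth a s (i + size t)) comm.
  by rewrite nth_cat ltnNge leq_addl /= addnK nth_cat lt_i.
have last_head e : infix (rcons v e) U -> e = nth a v 0.
  case/infixP=> [p [s eU]].
  have e1 : nth a U (size p) = nth a v 0.
    by rewrite eU nth_cat ltnn subnn nth_cat size_rcons nth_rcons sv t_gt0.
  have e2 : nth a U (size p + size t) = e.
    rewrite eU nth_cat ltnNge leq_addr addKn nth_cat size_rcons nth_rcons sv.
    by rewrite ltnSn ltnn eqxx.
  by rewrite -e1 per ?e2 // eU !size_cat size_rcons sv ltn_add2l ltn_addr ?leqnn.
have ea : a = nth a v 0 by apply: last_head; apply: HNa => //; lia.
have eb : b = nth a v 0 by apply: last_head; apply: HNb => //; lia.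
by rewrite ea -eb eqxx in ab.
Qed.

(* [codes W B] is the language of block sequences that can follow [W]. *)
Definition coded B u := flatten (map B u).

Definition codes W B u := L (W ++ coded B u).

Lemma coded_cat B u v : coded B (u ++ v) = coded B u ++ coded B v.
Proof. by rewrite /coded map_cat flatten_cat. Qed.

Lemma coded_cons B c u : coded B (c :: u) = B c ++ coded B u.
Proof. by []. Qed.

Lemma coded_seq1 B c : coded B [:: c] = B c.
Proof. by rewrite /coded /= cats0. Qed.

Lemma coded_rcons B u c : coded B (rcons u c) = coded B u ++ B c.
Proof. by rewrite -cats1 coded_cat coded_seq1. Qed.

(* [coding_last] says that every product of blocks read after [W] ends with [W],
   and that the letter before this [W] tells the last block. *)
Record coding W B : Prop := Coding {
  coding_head : exists (h : bool -> A) (t : bool -> seq A),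
    h false != h true /\ forall c, B c = h c :: t c;
  coding_last : exists (l : bool -> A) (x : bool -> seq A),
    l false != l true /\ forall c, W ++ B c = x c ++ l c :: W;
  coding_parse : forall z, L (W ++ z) -> exists c, prefix_cmp z (B c);
  coding_word : forall c, L (W ++ B c);
  coding_left : forall u, codes W B u -> exists c, codes W B (c :: u) }.

Section CodingTheory.
Context (W : seq A) (B : bool -> seq A) (C : coding W B).

Lemma coding_size_gt0 c : 0 < size (B c).
Proof. by have [h [t [_ ->]]] := coding_head C. Qed.

(** The blocks are told apart by the letter before the final [W], so [two_periods] applies. *)
Lemma coding_size_lt : size W < size (B false) + size (B true).
Proof.
have [l [x [ll lx]]] := coding_last C.
exact: two_periods ll (lx false) (lx true).
Qed.

Lemma coding_suffix u : suffix W (W ++ coded B u).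
Proof.
elim: u => [|c u /suffixP[y IHu]]; first by rewrite cats0 suffix_refl.
have [l [x [_ lx]]] := coding_last C.
rewrite coded_cons catA lx -catA cat_cons IHu.
by rewrite -cat_cons catA suffix_suffix.
Qed.

Lemma coding_last_rcons : exists l : bool -> A, l false != l true /\
  forall u c, suffix (l c :: W) (W ++ coded B (rcons u c)).
Proof.
have [l [x [ll lx]]] := coding_last C; exists l; split=> // u c.
have /suffixP[y ey] := coding_suffix u.
by rewrite coded_rcons catA ey -catA lx catA suffix_suffix.
Qed.

Lemma codes_infix u v u2 : codes W B (u ++ v ++ u2) -> codes W B v.
Proof.
rewrite /codes !coded_cat; have /suffixP[y ey] := coding_suffix u.
by rewrite catA ey -catA => /(lang_suffix HL); rewrite catA; apply: lang_prefix.
Qed.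

(** The sum serves as a common upper bound for both lengths. *)
Definition max_block B := size (B false) + size (B true).

Lemma leq_max_block c : size (B c) <= max_block B.
Proof. by rewrite /max_block; case: c; rewrite ?leq_addl ?leq_addr. Qed.

Lemma coding_read u z : L (W ++ coded B u ++ z) -> max_block B <= size z ->
  exists c, prefix (B c) z.
Proof.
have /suffixP[y ey] := coding_suffix u.
rewrite catA ey -catA => /(lang_suffix HL) /(coding_parse C)[c zc] le_z.
exists c; case/orP: zc => // zB; rewrite (prefix_eq_size zB) ?prefix_refl //.
exact: leq_trans (leq_max_block c) le_z.
Qed.

Lemma coding_readn n u z : L (W ++ coded B u ++ z) -> n * max_block B <= size z ->
  exists2 v, size v = n & prefix (coded B v) z.
Proof.
elim: n u z => [|n IHn] u z Lz le_z; first by exists [::]; rewrite ?prefix0s.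
have [|c /prefixP[z' ez]] := coding_read Lz.
  by apply: leq_trans le_z; rewrite mulSn leq_addr.
have [||v sv vz] := IHn (rcons u c) z'.
- by rewrite coded_rcons -catA -ez.
- move: le_z; rewrite ez size_cat mulSn; have := leq_max_block c; lia.
exists (c :: v); first by rewrite /= sv.
by case/prefixP: vz => z2 e2; rewrite ez e2 catA prefix_prefix.
Qed.

Lemma codes_readn n u z : L (W ++ coded B u ++ z) -> n * max_block B <= size z ->
  exists v, [/\ size v = n, prefix (coded B v) z & codes W B (u ++ v)].
Proof.
move=> Lz le_z; have [v sv vz] := coding_readn Lz le_z; exists v; split=> //.
case/prefixP: vz Lz => z' ->; rewrite catA catA -[(_ ++ _) ++ coded _ _]catA -coded_cat.
exact: lang_prefix.
Qed.

Lemma codes_rightn n u : codes W B u -> exists2 v, size v = n & codes W B (u ++ v).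
Proof.
move=> /(lang_rightn HL (n * max_block B))[z sz]; rewrite -catA => Lz.
by have [|v [sv _ Yv]] := codes_readn Lz (n := n); [rewrite sz | exists v].
Qed.

Lemma codes_leftn n u : codes W B u -> exists2 v, size v = n & codes W B (v ++ u).
Proof.
move=> Yu; elim: n => [|n [v <- Yv]]; first by exists [::].
by have [c Yc] := coding_left C Yv; exists (c :: v).
Qed.

Lemma codes_prefix u v : codes W B (u ++ v) -> codes W B u.
Proof. exact: (@codes_infix [::]). Qed.

Lemma codes_suffix u v : codes W B (u ++ v) -> codes W B v.
Proof. by move=> Y; apply: (@codes_infix u v [::]); rewrite cats0. Qed.

Lemma codes_nil : codes W B [::].
Proof.
apply: (@codes_prefix [::] [:: true]); rewrite /codes coded_seq1.
exact: coding_word.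
Qed.

Lemma codes_aperiodic t : t <> [::] -> exists N, ~ codes W B (flatten (nseq N t)).
Proof.
case: t => // c t _; have [N HN] : exists N, ~ L (flatten (nseq N (coded B (c :: t)))).
  apply: lang_aperiodic; rewrite /coded /= => /(congr1 size) /=; rewrite size_cat.
  by have := coding_size_gt0 c; lia.
exists N => /(lang_suffix HL).
suff -> : coded B (flatten (nseq N (c :: t))) = flatten (nseq N (coded B (c :: t))) by [].
by elim: N {HN} => //= N IHN; rewrite -cat_cons coded_cat IHN.
Qed.

Lemma codes_right_special u : codes W B (rcons u false) -> codes W B (rcons u true) ->
  right_special L (W ++ coded B u).
Proof.
have [h [t [hh hB]]] := coding_head C; rewrite /codes !coded_rcons !hB !catA => Y0 Y1.
exists (h false), (h true); rewrite hh -!cats1; split=> //.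
  by apply: (lang_prefix HL (v := t false)); rewrite -catA.
by apply: (lang_prefix HL (v := t true)); rewrite -catA.
Qed.

(* A word that stops inside a block determines its next letter, so a right special
   word stops at the end of a block. *)
Lemma right_special_suffix_coding y : right_special L (W ++ y) -> suffix W (W ++ y).
Proof.
have [h [t [hh hB]]] := coding_head C.
have [n] := ubnP (size y); elim: n y => // n IHn y lt_y RSy.
have [|] := boolP (nilp y) => [/nilP ->|y0]; first by rewrite cats0 suffix_refl.
have [a [b [ab La Lb]]] := RSy.
have [c ca] : exists c, prefix_cmp (rcons y a) (B c).
  by apply: (coding_parse C); rewrite -rcons_cat.
have [d db] : exists c, prefix_cmp (rcons y b) (B c).
  by apply: (coding_parse C); rewrite -rcons_cat.
have head_cmp e f : prefix_cmp (rcons y e) (B f) -> head e y = h f.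
  by rewrite hB; case: y y0 {IHn lt_y RSy La Lb ca db} => //= g y _;
    rewrite /prefix_cmp /= => /orP[] /andP[/eqP ->].
have cd : d = c.
  have := head_cmp _ _ ca; have := head_cmp _ _ db.
  case: y y0 {IHn lt_y RSy La Lb ca db head_cmp} => //= g y _ -> hdc.
  by case: c d hdc hh => [] [] // -> /eqP.
rewrite {d}cd in db.
(* If the whole block fits into [y], it is removed: what remains is again [W] followed by a shorter
   word. Otherwise both extensions of [y] are prefixes of the same block. *)
have [le_cy|lt_yc] := leqP (size (B c)) (size y).
  have /prefixP[y' ey] : prefix (B c) y.
    apply: (@prefix_leq_total _ _ _ (rcons y a)) => //; last exact: prefix_rcons.
    case/orP: ca => // /prefix_eq_size; rewrite size_rcons => e.
    by rewrite e ?prefix_refl //; apply: leq_trans le_cy _.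
  have [l [x [_ lx]]] := coding_last C.
  have eW : W ++ y = rcons (x c) (l c) ++ (W ++ y') by rewrite ey (catA W) lx -cats1 -!catA.
  rewrite eW; apply: suffix_trans (suffix_suffix _ _); apply: IHn.
    by move: lt_y; rewrite ey size_cat; have := coding_size_gt0 c; lia.
  by apply: right_special_suffix RSy => //; rewrite eW suffix_suffix.
have full e : prefix_cmp (rcons y e) (B c) -> prefix (rcons y e) (B c).
  case/orP=> // /prefix_eq_size -> //; first exact: prefix_refl.
  by rewrite size_rcons.
have := prefix_leq_total (full _ ca) (full _ db); rewrite !size_rcons leqnn => /(_ isT).
move=> /prefix_eq_size; rewrite !size_rcons leqnn => /(_ isT) /rcons_inj[/eqP].
by rewrite (negPf ab).
Qed.

(** By recurrence a long right special word contains [W]; its part from there on ends with [W] by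
    [right_special_suffix_coding]. Its suffix of length [i] is the required word. *)
Lemma right_special_cmp i : exists z,
  [/\ size z = i, right_special L z & suffix_cmp z W].
Proof.
have LW : L W by have := codes_nil; rewrite /codes cats0.
have [N HN] := lang_rec HL LW.
have [z sz RSz] := lang_special HL (N + size W + i).
have Lz : L z by have [a [_ [_ La _]]] := RSz; move: La; rewrite -cats1 => /(lang_prefix HL).
have Wz : suffix W z.
  have /infixP[x [y ez]] : infix W z by apply: HN => //; lia.
  rewrite ez; apply: suffix_trans (suffix_suffix _ _); apply: right_special_suffix_coding.
  by apply: right_special_suffix RSz => //; rewrite ez suffix_suffix.
have sz' : suffix (drop (size z - i) z) z.
  by apply/suffixP; exists (take (size z - i) z); rewrite cat_take_drop.
exists (drop (size z - i) z); split; first by rewrite size_drop; lia.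
  exact: right_special_suffix RSz.
exact: suffix_total Wz.
Qed.

End CodingTheory.
End Coding.

(** * One step: passing to the blocks [o] and [r^D o] *)

Section Step.
Context (A : finType) (L : seq A -> Prop) (HL : recurrent_language L).
Implicit Types (c r : bool) (D : nat) (u v : seq bool) (z W : seq A)
  (B : bool -> seq A).

(* The new block of index [false] is [o], that of index [true] is [r^D o], where
   [o = ~~ r]. *)
Definition step_word r D c := rcons (nseq (if c then D else 0) r) (~~ r).

Definition step_code B r D c := coded B (step_word r D c).

Lemma coded_step B r D u :
  coded (step_code B r D) u = coded B (coded (step_word r D) u).
Proof.
by elim: u => //= c u IHu; rewrite [RHS]coded_cat -IHu.
Qed.

(** [stepping_max] also controls runs at the ends of a block sequence, where [stepping_gap] says
    nothing; the last two fields make both new blocks occur after [W ++ B (~~ r)]. *)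
Record stepping W B r D : Prop := Stepping {
  stepping_gt0 : 0 < D;
  stepping_gap : forall j,
    codes L W B (~~ r :: nseq j r ++ [:: ~~ r]) -> j = 0 \/ j = D;
  stepping_max : ~ codes L W B (nseq D.+1 r);
  stepping_occ : codes L W B (~~ r :: nseq D r ++ [:: ~~ r]);
  stepping_occ0 : codes L W B [:: ~~ r; ~~ r] }.

Context (W : seq A) (B : bool -> seq A) (C : coding L W B).
Context (r : bool) (D : nat) (S : stepping W B r D).

Lemma codes_step u : codes L (W ++ B (~~ r)) (step_code B r D) u <->
  codes L W B (~~ r :: coded (step_word r D) u).
Proof. by rewrite /codes coded_step -catA. Qed.

Lemma codes_run j : codes L W B (nseq j r) -> j <= D.
Proof.
move=> Yj; rewrite leqNgt; apply/negP => lt_Dj; case: (stepping_max S).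
apply: (codes_prefix HL C (v := nseq (j - D.+1) r)).
by rewrite cat_nseq /ncons -iterD -/(ncons _ _ _) subnKC.
Qed.

Lemma codes_gap j u : codes L W B (~~ r :: nseq j r ++ (~~ r) :: u) -> j = 0 \/ j = D.
Proof.
move=> Y; apply: (stepping_gap S); apply: (codes_prefix HL C (v := u)).
by rewrite /= -catA.
Qed.

(** Cutting after every [~~ r] gives new blocks by [codes_gap]; the unfinished run at the end is
    [nseq i r]. *)
Lemma step_parse v : codes L W B (~~ r :: v) -> exists u i,
  [/\ v = coded (step_word r D) u ++ nseq i r, i <= D &
      codes L (W ++ B (~~ r)) (step_code B r D) u].
Proof.
have [n] := ubnP (size v); elim: n v => // n IHn v lt_v Yv.
have [ev|[j [v' ev]]] := run_split r v.
  exists [::], (size v); split=> //.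
    by apply: codes_run; rewrite -ev; apply: (codes_suffix HL C (u := [:: ~~ r])).
  by apply/codes_step; apply: (codes_prefix HL C (v := v)).
have ej : exists c, v = step_word r D c ++ v'.
  by move: Yv; rewrite ev => /codes_gap[->|->]; [exists false | exists true];
    rewrite /step_word cat_rcons.
case: ej => c ec; have [||u [i [ev' le_i Yu]]] := IHn v'.
- by move: lt_v; rewrite ev size_cat /=; lia.
- apply: (codes_suffix HL C (u := ~~ r :: nseq j r)).
  by rewrite cat_cons -ev.
exists (c :: u), i; split=> //; first by rewrite ec ev' catA.
apply/codes_step; apply: (codes_prefix HL C (v := nseq i r)).
by rewrite /= -catA -/(coded _ _) -ev' -ec.
Qed.

Lemma coding_step : coding L (W ++ B (~~ r)) (step_code B r D).
Proof.
have D0 := stepping_gt0 S.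
have [h [t [hh hB]]] := coding_head C.
have [l [ll lx]] := coding_last_rcons C.
have codeE c : step_code B r D c = coded B (nseq (if c then D else 0) r) ++ B (~~ r).
  by rewrite /step_code /step_word coded_rcons.
split.
- exists (fun c => h (if c then r else ~~ r)).
  exists (fun c => behead (step_code B r D c)); split.
    by case: (r) hh; rewrite // eq_sym.
  move=> [] /=; rewrite codeE; last by rewrite hB.
  by case: D D0 => //= n _; rewrite /coded /= hB.
(* In [~~ r] followed by the new block [c], the old block before the last one is [d c], so the
   letter [l (d c)] precedes the final [W ++ B (~~ r)]. *)
- pose d c := if c then r else ~~ r.
  have last_step c : exists x, (W ++ B (~~ r)) ++ step_code B r D c =
      x ++ l (d c) :: (W ++ B (~~ r)).
    have [u eu] : exists u, ~~ r :: nseq (if c then D else 0) r = rcons u (d c).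
      case: c; last by exists [::].
      exists (~~ r :: nseq D.-1 r); rewrite -[in LHS](prednK D0) -addn1 nseqD.
      by rewrite -cats1.
    have /suffixP[x ex] := lx u (d c); exists x; rewrite codeE -cat_cons.
    rewrite [RHS]catA -ex -eu coded_cons.
    by rewrite -!catA.
  have [[x0 e0] [x1 e1]] := (last_step false, last_step true).
  exists (l \o d), (fun c => if c then x1 else x0); split; last by case.
  by rewrite /d /=; case: (r) ll; rewrite // eq_sym.
(* Among the [D.+1] old blocks read here one is [~~ r], so a first new block is complete. *)
- move=> z Lz; have [z2 sz2] := lang_rightn HL (D.+1 * max_block B) Lz.
  rewrite -!catA -{1}[B _]coded_seq1 => Lz2.
  have [|v [sv vz Yv]] := codes_readn HL C (n := D.+1) Lz2.
    by rewrite size_cat sz2 leq_addl.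
  have [[|c u] [i [ev le_i _]]] := step_parse Yv.
    by move: sv; rewrite ev size_nseq; lia.
  exists c; apply: (@prefix_total _ _ _ (z ++ z2)); first exact: prefix_prefix.
  case/prefixP: vz => z3 ->; rewrite ev coded_cat coded_cons.
  by rewrite coded_cat -!catA prefix_prefix.
- move=> c; have := codes_step [:: c]; rewrite {1}/codes coded_seq1 => ->.
  rewrite coded_seq1; case: c; last exact: (stepping_occ0 S).
  by rewrite /step_word -cats1; apply: (stepping_occ S).
(* Some [~~ r] occurs among [D.+1] old blocks to the left; the run between it and the leading [~~ r]
   completes a new block. *)
- move=> u /codes_step Yu; have [v sv Yv] := codes_leftn C D.+1 Yu.
  have [ev|[j [v' ev]]] := run_split_r r v.
    by case: (stepping_max S); rewrite -sv -ev; apply: codes_prefix Yv.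
  have Yj : codes L W B (~~ r :: nseq j r ++ (~~ r) :: coded (step_word r D) u).
    by apply: (codes_suffix HL C (u := v')); move: Yv; rewrite ev -catA.
  have [c ec] : exists c, nseq j r ++ [:: ~~ r] = step_word r D c.
    by case: (codes_gap Yj) => ->; [exists false | exists true]; rewrite // /step_word -cats1.
  exists c; apply/codes_step; rewrite coded_cons.
  by rewrite -ec -catA.
Qed.

End Step.

Lemma sum_interval a n p q : p <= a.+1 -> a + n <= q ->
  \sum_(p <= i < q.+1) (a < i <= a + n) = n.
Proof.
move=> le_pa le_q.
rewrite (@big_cat_nat _ _ _ a.+1) //=; last by lia.
rewrite (@big_cat_nat _ _ _ (a + n).+1 a.+1 q.+1) //=; try lia.
rewrite big_nat big1 => [|i /andP[_ lt_i]]; last by rewrite ltnNge -ltnS lt_i.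
rewrite add0n big_nat (eq_bigr (fun=> 1)) => [|i /andP[lt_i le_i]]; last first.
  by rewrite lt_i -ltnS le_i.
rewrite -big_nat sum_nat_const_nat muln1.
rewrite big_nat big1 => [|i /andP[lt_i _]]; first by rewrite addn0; lia.
by rewrite [i <= _]leqNgt lt_i andbF.
Qed.

Lemma size_coded_nseq (A : finType) (B : bool -> seq A) n c :
  size (coded B (nseq n c)) = n * size (B c).
Proof. by elim: n => //= n IHn; rewrite size_cat IHn mulSn. Qed.

(** * Existence of a step and the right special words it reveals *)

Section Choice.
Context (A : finType) (L : seq A -> Prop) (HL : recurrent_language L).
Implicit Types (c r : bool) (D : nat) (u v : seq bool) (z W : seq A)
  (B : bool -> seq A).

Section Codes.
Context (W : seq A) (B : bool -> seq A) (C : coding L W B).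
Local Notation Y := (codes L W B).

Lemma codes_run_bound c : exists N, forall n, N <= n -> ~ Y (nseq n c).
Proof.
have [N HN] := codes_aperiodic HL C (t := [:: c]) ltac:(by []).
exists N => n le_n Yn; apply: HN.
have -> : flatten (nseq N [:: c]) = nseq N c by elim: N {le_n} => //= N ->.
apply: (codes_prefix HL C (v := nseq (n - N) c)).
by rewrite -nseqD subnKC.
Qed.

(** Long extensions on both sides must leave the run, since runs have bounded length. *)
Lemma codes_run_extend c m : 0 < m -> Y (nseq m c) ->
  exists2 j, m <= j & Y (~~ c :: nseq j c ++ [:: ~~ c]).
Proof.
move=> m0 Ym; have [N HN] := codes_run_bound c.
have [v1 sv1 Yv1] := codes_leftn C N Ym.
have [v2 sv2 Yv2] := codes_rightn HL C N Yv1.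
have [e1|[i [v1' e1]]] := run_split_r c v1.
  by case: (HN N) => //; rewrite -sv1 -e1; apply: codes_prefix Yv1.
have [e2|[k [v2' e2]]] := run_split c v2.
  by case: (HN N) => //; rewrite -sv2 -e2; apply: codes_suffix Yv2.
exists (i + m + k); first by lia.
apply: (codes_infix HL C (u := v1') (u2 := v2')).
by move: Yv2; rewrite e1 e2 !nseqD /= -!catA.
Qed.

Lemma codes_letter c : Y [:: c].
Proof. by rewrite /codes coded_seq1; exact: (coding_word C). Qed.

(** Otherwise the two blocks alternate, against [codes_aperiodic]. *)
Lemma codes_square : Y [:: false; false] \/ Y [:: true; true].
Proof.
apply: contrapT => /not_orP[nff ntt].
have [N HN] := codes_aperiodic HL C (t := [:: false; true]) ltac:(by []).
have alt n u : size u = n.*2.+1 -> Y (false :: u) ->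
    false :: u = flatten (nseq n.+1 [:: false; true]).
  elim: n u => [|n IHn] [|d u] // su Yu.
    case: d Yu su => [_|Yff _]; first by case: u.
    by case: nff; apply: codes_prefix Yff.
  case: d Yu su => [|Yff _]; last by case: nff; apply: codes_prefix Yff.
  case: u => [|[] u] // Yu.
    by case: ntt; apply: (codes_infix HL C (u := [:: false]) (u2 := u)).
  move=> [su].
  have -> : flatten (nseq n.+2 [:: false; true]) =
    [:: false, true & flatten (nseq n.+1 [:: false; true])] by [].
  rewrite -(IHn u) //.
  exact: (codes_suffix HL C (u := [:: false; true])).
have [v sv Yv] := codes_rightn HL C N.*2.+1 (codes_letter false).
apply: HN; have := Yv; rewrite [_ ++ _]/= (alt N) // -addn1 nseqD flatten_cat.
exact: codes_prefix.
Qed.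

Lemma rcons_nseq c m : rcons (nseq m c) c = nseq m.+1 c.
Proof. by rewrite -cats1 -(nseqD m 1) addn1. Qed.

(* The block sequence [(~~ c) c^(m + 1)] is right special. *)
Definition special_run c :=
  exists m, forall d, Y (rcons (rcons (~~ c :: nseq m c) c) d).

(** Runs of [r] then have length at most 1, and the square of the other block occurs by
    [codes_square]. *)
Lemma stepping_square r : ~ Y [:: r; r] -> stepping L W B r 1.
Proof.
move=> nrr; have short j : Y (nseq j r) -> j <= 1.
  case: j => [|[|j]] // Yj; case: nrr.
  by apply: (codes_prefix HL C (v := nseq j r)).
have mid j : Y (~~ r :: nseq j r ++ [:: ~~ r]) -> j <= 1.
  by move=> Yj; apply: short; apply: (codes_infix HL C (u := [:: ~~ r])) Yj.
split=> //.
- by move=> j /mid; case: j => [|[|]]; [left | right |].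
- have [j le_j Yj] := codes_run_extend (m := 1) isT (codes_letter r).
  by have := mid j Yj; move: Yj; have [->|] := eqVneq j 1 => //; lia.
- by have [] := codes_square; case: (r) nrr.
Qed.

(** If two positive run lengths [i < j] occurred, [~~ r] followed by [r^i] would be right special:
    [~~ r] follows in the short run and [r] in the long one. *)
Lemma stepping_run r : Y [:: r; r] -> Y [:: ~~ r; ~~ r] -> ~ special_run r ->
  exists D, stepping L W B r D.
Proof.
move=> Yrr Yoo nspec.
have [D D2 YD] := codes_run_extend (m := 2) isT Yrr.
have short i j : 0 < i -> i < j -> Y (~~ r :: nseq i r ++ [:: ~~ r]) ->
    ~ Y (~~ r :: nseq j r ++ [:: ~~ r]).
  case: i => // i _ lt_ij Yi Yj; apply: nspec; exists i => d.
  rewrite rcons_cons rcons_nseq; have [->|] := eqVneq d r; last first.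
    by move: Yi; rewrite -cats1; case: (d) (r) => [] [].
  apply: (codes_prefix HL C (v := nseq (j - i.+2) r ++ [:: ~~ r])).
  by rewrite rcons_cons rcons_nseq cat_cons catA -nseqD subnKC.
have gap j : Y (~~ r :: nseq j r ++ [:: ~~ r]) -> j = 0 \/ j = D.
  move=> Yj; case: (posnP j) => [|j0]; first by left.
  right; case: (ltngtP j D) => // lt_jD.
    by have := short _ _ j0 lt_jD Yj.
  by have := short D j ltac:(lia) lt_jD YD.
exists D; split=> //; first by lia.
move=> /codes_run_extend[] // j lt_Dj /gap; lia.
Qed.

(** [z] is a suffix of the right special word [W ++ coded B (rcons u c)], long enough to contain the
    letter [l c] before the final [W]. *)
Lemma special_branch (l : bool -> A) u c i :
  (forall u c, suffix (l c :: W) (W ++ coded B (rcons u c))) ->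
  Y (rcons (rcons u c) false) -> Y (rcons (rcons u c) true) ->
  size W < i <= size W + size (coded B (rcons u c)) ->
  exists z, [/\ size z = i, right_special L z & suffix (l c :: W) z].
Proof.
move=> lx Y0 Y1 /andP[lt_i le_i].
set x := W ++ coded B (rcons u c).
have RSx : right_special L x by apply: (codes_right_special HL C).
have sx : suffix (drop (size x - i) x) x.
  by apply/suffixP; exists (take (size x - i) x); rewrite cat_take_drop.
have sz : size (drop (size x - i) x) = i.
  by rewrite size_drop subKn // /x size_cat.
exists (drop (size x - i) x); split=> //.
  exact: right_special_suffix RSx.
by apply: suffix_leq_total (lx u c) sx _; rewrite sz.
Qed.

Lemma suffix_cons_cmp (l : bool -> A) c d z z' : l c != l d ->
  suffix (l c :: W) z -> suffix (l d :: W) z' -> ~~ suffix_cmp z z'.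
Proof.
move=> lcd cz dz'; apply: contra lcd => zz'.
have [y [cy dy]] : exists y, suffix (l c :: W) y /\ suffix (l d :: W) y.
  case/orP: zz' => h; [exists z' | exists z]; split=> //.
    exact: suffix_trans cz h.
  exact: suffix_trans dz' h.
have := suffix_leq_total cy dy (leqnn _).
by rewrite suffixE /= subnn drop0 => /eqP[->].
Qed.

End Codes.

(** The truncated subtraction is exact for a coding, by [coding_size_lt]. *)
Definition excess W B := size (B false) + size (B true) - size W.
Definition min_block B := minn (size (B false)) (size (B true)).

Lemma excess_gt0 W B : coding L W B -> 0 < excess W B.
Proof. by move=> C; rewrite subn_gt0 (coding_size_lt C). Qed.

Section StepSizes.
Context (W : seq A) (B : bool -> seq A) (C : coding L W B).
Context (r : bool) (D : nat) (S : stepping L W B r D).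
Local Notation W' := (W ++ B (~~ r)).
Local Notation B' := (step_code B r D).

Lemma size_step_code c :
  size (step_code B r D c) = (if c then D else 0) * size (B r) + size (B (~~ r)).
Proof.
by rewrite /step_code /step_word coded_rcons size_cat size_coded_nseq.
Qed.

Lemma size_block_sum : size (B false) + size (B true) = size (B r) + size (B (~~ r)).
Proof. by case: (r) => //=; rewrite addnC. Qed.

Lemma min_block_sym : min_block B = minn (size (B r)) (size (B (~~ r))).
Proof. by rewrite /min_block; case: (r) => //=; rewrite minnC. Qed.

Lemma excess_step : excess W' B' = excess W B + D.-1 * size (B r).
Proof.
rewrite /excess !size_step_code size_cat size_block_sum.
have := coding_size_lt C; rewrite size_block_sum.
by case: D (stepping_gt0 S) => // n _ /=; lia.
Qed.

Lemma min_block_step : min_block B' = size (B (~~ r)).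
Proof. by rewrite /min_block !size_step_code mul0n add0n; apply/minn_idPl/leq_addl. Qed.

End StepSizes.

Context (Q e0 : nat).
(* [counted_off] and [nwords_base] below give [q + excess W B <= p(q + 1)] for the
   [q] considered: each length has a right special word comparable with [W], and
   [counted_off] counts the other ones. *)
Record counted W B : Prop := Counted {
  counted_size : Q <= (size W).+1;
  counted_off : forall q, size W <= q -> (excess W B).*2 + min_block B <= q ->
    excess W B <= e0 + \sum_(Q <= i < q.+1) nspecial_off L W i }.

Section Step.
Context (W : seq A) (B : bool -> seq A) (C : coding L W B) (HC : counted W B).
Context (r : bool) (D : nat) (S : stepping L W B r D).
Local Notation W' := (W ++ B (~~ r)).
Local Notation B' := (step_code B r D).

(** The block sequence [r^(D - 1)] can be followed by [r] and by [~~ r]. The words of its branch end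
    with [l r :: W], while [W'] ends with [l (~~ r) :: W]: they are comparable with [W] but not with
    [W']. *)
Lemma nspecial_off_step i :
  nspecial_off L W i + (size W < i <= size W + D.-1 * size (B r))
    <= nspecial_off L W' i.
Proof.
have WW' : suffix W W'.
  by have := coding_suffix C [:: ~~ r]; rewrite coded_seq1.
have [lt_i|_] /= := boolP (_ < i <= _); last by rewrite addn0 nspecial_off_leq.
have [l [ll lx]] := coding_last_rcons C.
have D2 : 0 < D.-1 by case: (D.-1) lt_i => // /andP[]; lia.
have eD : rcons (nseq D.-2 r) r = nseq D.-1 r by rewrite rcons_nseq prednK.
have Yd d : codes L W B (rcons (nseq D.-1 r) d).
  have YD := stepping_occ S; have [->|dr] := eqVneq d r.
    rewrite rcons_nseq prednK ?(stepping_gt0 S) //.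
    exact: (codes_infix HL C (u := [:: ~~ r]) (u2 := [:: ~~ r])).
  have -> : d = ~~ r by case: (d) (r) dr => [] [].
  apply: (codes_suffix HL C (u := [:: ~~ r; r])); rewrite -cats1.
  by move: YD; rewrite -[in nseq D r](prednK (stepping_gt0 S)).
have [|||z [sz RSz zl]] := @special_branch _ _ C l (nseq D.-2 r) r i lx.
- by rewrite eD.
- by rewrite eD.
- by rewrite eD size_coded_nseq.
have lr : l r != l (~~ r) by case: (r) ll; rewrite // eq_sym.
rewrite addn1; apply: (nspecial_off_lt WW' sz RSz).
  by apply/orP; right; apply: suffix_trans zl; rewrite -[l r :: W]cat1s suffix_suffix.
apply: suffix_cons_cmp lr zl _.
by have := lx [::] (~~ r); rewrite coded_seq1.
Qed.

Lemma sum_nspecial_off_step q : size W + D.-1 * size (B r) <= q ->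
  \sum_(Q <= i < q.+1) nspecial_off L W i + D.-1 * size (B r)
    <= \sum_(Q <= i < q.+1) nspecial_off L W' i.
Proof.
move=> le_q; rewrite -{1}(sum_interval (counted_size HC) le_q) -big_split /=.
by apply: leq_sum => i _; apply: nspecial_off_step.
Qed.

Lemma counted_step : counted W' B'.
Proof.
have e_gt0 := excess_gt0 C; have le_Q := counted_size HC.
split; first by rewrite size_cat; lia.
move=> q; rewrite (excess_step C S) min_block_step size_cat => le_wq le_eq.
have ew : excess W B + size W = size (B r) + size (B (~~ r)).
  by rewrite -(size_block_sum B r); have := coding_size_lt C; rewrite /excess; lia.
(* With [a], [b] the lengths of [B r], [B (~~ r)] and [D >= 2], this follows from [size W <= a + b]
   and [a <= (D - 1) a], as [q] is at least [2 (D - 1) a + b]. *)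
have le_q : size W + D.-1 * size (B r) <= q.
  have [->|D2] := posnP D.-1; first by lia.
  have : size (B r) <= D.-1 * size (B r) by rewrite leq_pmull.
  by lia.
have le_min : min_block B <= size (B (~~ r)) by rewrite (min_block_sym B r) geq_minr.
have le_eq' : (excess W B).*2 + min_block B <= q.
  by apply: leq_trans le_eq; rewrite leq_add // leq_double leq_addr.
have := counted_off HC (q := q) (leq_trans (leq_addr _ _) le_wq) le_eq'.
by have := sum_nspecial_off_step le_q; lia.
Qed.

End Step.

(** * Consequences of the complexity bound *)

Section Complexity.
Context (K Q0 : nat).
Context (complexity_leq : forall q m, Q0 <= q -> q + m <= nwords L q.+1 ->
  K.*2.+1 * m <= K * q).
Context (lt_Q0 : Q0 < Q) (nwords_base : Q + e0 <= (nwords L Q).+1).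

(** The strict inequality gives one more right special word for each length, which makes up the term
    [q]; [f] counts further ones. *)
Lemma nwords_main W q (f : nat -> nat) : Q <= q.+1 ->
  (forall i, nspecial_off L W i + f i < nspecial L i) ->
  q + e0 + \sum_(Q <= i < q.+1) nspecial_off L W i + \sum_(Q <= i < q.+1) f i
    <= nwords L q.+1.
Proof.
move=> le_Q lt_f; apply: leq_trans (nwords_sum HL le_Q).
have : \sum_(Q <= i < q.+1) (nspecial_off L W i + f i + 1)
    <= \sum_(Q <= i < q.+1) nspecial L i.
  by apply: leq_sum => i _; rewrite addn1.
rewrite !big_split /= sum_nat_const_nat muln1; move: nwords_base le_Q.
lia.
Qed.

(* Two branches of right special words of lengths in ]|W|, |W| + |B0| + |B1|] make
   the complexity exceed 3/2 at the end of this range. *)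
Lemma not_both_special_run W B : coding L W B -> counted W B ->
  special_run W B false -> special_run W B true -> False.
Proof.
move=> C HC [m0 Y0] [m1 Y1].
have [l [ll lx]] := coding_last_rcons C.
pose s := size (B false) + size (B true).
have e_gt0 := excess_gt0 C.
have off2 i : nspecial_off L W i + (size W < i <= size W + s) < nspecial L i.
  have [lt_i|_] /= := boolP (_ < i <= _); last first.
    by have [z [sz RSz zW]] := right_special_cmp HL C i; rewrite addn0 (nspecial_gt sz).
  have branch c m : (forall d, codes L W B (rcons (rcons (~~ c :: nseq m c) c) d)) ->
      exists z, [/\ size z = i, right_special L z & suffix (l c :: W) z].
    move=> Yd; apply: (@special_branch _ _ C l _ c i lx (Yd false) (Yd true)).
    move: lt_i => /andP[-> /leq_trans]; apply; rewrite leq_add2l /s.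
    rewrite coded_rcons coded_cons !size_cat; case: (c) => /=; lia.
  have [z0 [sz0 RS0 l0]] := branch _ _ Y0.
  have [z1 [sz1 RS1 l1]] := branch _ _ Y1.
  have Wl c : suffix W (l c :: W) by rewrite -[l c :: W]cat1s suffix_suffix.
  rewrite addn1 -addn2; apply: (nspecial_gt1 sz0 sz1) => //.
  - apply: contraNneq (suffix_cons_cmp ll l0 l1) => ->.
    by rewrite /suffix_cmp suffix_refl.
  - by apply/orP; right; apply: suffix_trans l0.
  - by apply/orP; right; apply: suffix_trans l1.
(* The first entry is the end of the range with two branches, the second the threshold of
   [counted_off]. *)
set q := maxn (size W + s) ((excess W B).*2 + min_block B).
have le_q : size W + s <= q by rewrite leq_maxl.
have := counted_off HC (q := q) _ _; move=> /(_ ltac:(lia) ltac:(lia)) off_q.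
have le_Q := counted_size HC.
have := @nwords_main W q (fun i => size W < i <= size W + s) ltac:(lia) off2.
rewrite sum_interval // => main_q.
have : K.*2.+1 * (excess W B + s) <= K * q by apply: complexity_leq; lia.
(* With [m = excess W B + s] this reads [q <= 2 m], so [K * q <= 2 K m], which is less than
   [(2 K + 1) m]. *)
have le_q2 : q <= (excess W B + s).*2.
  by rewrite geq_max /excess /min_block /s; have := coding_size_lt C; lia.
have := leq_mul (leqnn K) le_q2; move: e_gt0; clear; lia.
Qed.

Lemma stepping_exists W B : coding L W B -> counted W B ->
  exists r D, stepping L W B r D.
Proof.
move=> C HC.
have [Y0|/(stepping_square C)] := pselect (codes L W B [:: false; false]); last first.
  by exists false, 1.
have [Y1|/(stepping_square C)] := pselect (codes L W B [:: true; true]); last first.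
  by exists true, 1.
have [s0|] := pselect (special_run W B false); last first.
  by move=> /(stepping_run C Y0 Y1)[D]; exists false, D.
have [s1|] := pselect (special_run W B true); last first.
  by move=> /(stepping_run C Y1 Y0)[D]; exists true, D.
by case: (not_both_special_run C HC s0 s1).
Qed.

Section StepConstraint.
Context (W : seq A) (B : bool -> seq A) (C : coding L W B) (HC : counted W B).
Context (r : bool) (D : nat) (S : stepping L W B r D).
Local Notation W' := (W ++ B (~~ r)).
Local Notation B' := (step_code B r D).

(* Evaluates the complexity at the length where the branch of the right special
   word [r^(D - 1)] ends. *)
Lemma step_constraint : 1 < D ->
  (3 * K + 1) * excess W B + (K * (D - 2) + D.-1) * size (B r) <= K * size (B (~~ r)).
Proof.
move=> D2; have e_gt0 := excess_gt0 C; have le_Q := counted_size HC.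
have ew : excess W B + size W = size (B r) + size (B (~~ r)).
  by rewrite -(size_block_sum B r); have := coding_size_lt C; rewrite /excess; lia.
set X := D.-1 * size (B r).
have le_X : size (B r) <= X by rewrite leq_pmull //; lia.
pose q := maxn (size W + X) ((excess W B).*2 + min_block B).
have le_q : size W + X <= q by rewrite leq_maxl.
have := counted_off HC (q := q) _ _; move=> /(_ ltac:(lia) ltac:(lia)) off_q.
have := @nwords_main W' q (fun=> 0) ltac:(lia).
have main i : nspecial_off L W' i + 0 < nspecial L i.
  have [z [sz RSz zW]] := right_special_cmp HL (coding_step HL C S) i.
  by rewrite addn0 (nspecial_gt sz).
move=> /(_ main) main_q; have sum_q := sum_nspecial_off_step C HC S le_q.
have : K.*2.+1 * (excess W B + X) <= K * q by apply: complexity_leq; lia.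
(* In the first case [size W = a + b - e] turns the inequality into the claim. The second is
   impossible: there [q = 2 e + min_block B] and [min_block B <= X]. *)
have [le2|lt1] := leqP ((excess W B).*2 + min_block B) (size W + X).
  rewrite /q (maxn_idPl le2).
  have eX : (D - 2) * size (B r) + size (B r) = X.
    by rewrite /X -mulSnr; congr (_ * _); lia.
  rewrite [(_ + D.-1) * _]mulnDl -mulnA.
  rewrite -/X; have := congr1 (muln K) ew; have := congr1 (muln K) eX.
  by clear; lia.
rewrite /q (maxn_idPr (ltnW lt1)).
have : K * min_block B <= K * X.
  by rewrite leq_mul2l (leq_trans _ le_X) ?orbT // (min_block_sym B r) geq_minl.
by move: e_gt0; clear; lia.
Qed.
End StepConstraint.
End Complexity.
End Choice.

(** * Return words of a right special word *)

Section Base.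
Context (A : finType) (L : seq A -> Prop) (HL : recurrent_language L).
Implicit Types (d e : A) (c : bool) (u : seq bool) (z F r s t x y : seq A).

Section ReturnWords.
Context (V : seq A).
Context (V_unique : forall z, size z = size V -> right_special L z -> z = V).

(** Two different extensions would make the suffix of [F] of length [size V] right special, hence
    equal to [V]. *)
Lemma deterministic F d e : size V <= size F -> ~~ suffix V F ->
  L (rcons F d) -> L (rcons F e) -> d = e.
Proof.
move=> le_V nV Ld Le; apply/eqP; apply: contraNT nV => de.
have sF : suffix (drop (size F - size V) F) F.
  by apply/suffixP; exists (take (size F - size V) F); rewrite cat_take_drop.
rewrite -(V_unique (z := drop (size F - size V) F)) //; first by rewrite size_drop subKn.
by apply: right_special_suffix sF _ => //; exists d, e.
Qed.

(* As long as [V] does not reappear, each letter is determined by the past. *)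
Lemma deterministic_prefix F r s : size V <= size F -> L (F ++ r) -> L (F ++ s) ->
  (forall n, n < size r -> ~~ suffix V (F ++ take n r)) -> prefix_cmp r s.
Proof.
elim: r s F => [|d r IHr] [|e s] F le_V Lr Ls nV //.
have de : d = e.
  apply: (deterministic le_V); first by have := nV 0 isT; rewrite take0 cats0.
    by apply: (lang_prefix HL (v := r)); rewrite cat_rcons.
  by apply: (lang_prefix HL (v := s)); rewrite cat_rcons.
rewrite /prefix_cmp /= de eqxx /=; apply: (IHr _ (rcons F e)).
- by rewrite size_rcons leqW.
- by rewrite cat_rcons -de.
- by rewrite cat_rcons.
- by move=> n lt_n; have := nV n.+1 lt_n; rewrite /= cat_rcons de.
Qed.

(** These are the return words to [V]; the two occurrences of [V] in [V ++ r] may overlap. *)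
Definition first_return r := [/\ L (V ++ r), suffix V (V ++ r) &
  forall n, 0 < n < size r -> ~~ suffix V (V ++ take n r)].

Lemma first_return_exists d : L (rcons V d) -> exists r, first_return (d :: r).
Proof.
move=> Ld; have LV : L V by apply: (lang_prefix HL (v := [:: d])); rewrite cats1.
have [N HN] := lang_rec HL LV; have [s ss] := lang_rightn HL N Ld.
rewrite cat_rcons => Ls.
have /infixP[s1 [s2 es]] : infix V s.
  apply: HN; last by rewrite ss.
  by apply: (lang_suffix HL (u := rcons V d)); rewrite cat_rcons.
have exn : exists n, (0 < n <= size (d :: s)) && suffix V (V ++ take n (d :: s)).
  exists (size (s1 ++ V)).+1; rewrite es /= !size_cat ltnS addnA leq_addr /=.
  by rewrite catA -size_cat take_size_cat // -!cat_cons catA suffix_suffix.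
case: (ex_minnP exn) => -[//|m] /andP[le_m Vm] min_m.
have le_ms : m <= size s by exact: le_m.
exists (take m s); split=> //.
  apply: (lang_prefix HL (v := drop m s)); rewrite -catA cat_cons cat_take_drop //.
move=> n /andP[n0]; rewrite /= size_takel // ltnS => le_n; apply/negP => Vn.
case: n n0 le_n Vn => // n _ le_n; rewrite /= take_takel // 1?ltnW // => Vn.
have := min_m n.+1; rewrite /= Vn andbT (leq_trans (ltnW le_n) le_ms : n < size (d :: s)).
by move=> /(_ isT); rewrite ltnS leqNgt le_n.
Qed.

Context (h : bool -> A) (hh : h false != h true).
Context (h_ext : forall d, L (rcons V d) -> exists c, d = h c).
Context (B : bool -> seq A) (t : bool -> seq A).
Context (B_head : forall c, B c = h c :: t c) (B_return : forall c, first_return (B c)).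

Lemma return_parse z : L (V ++ z) -> exists c, prefix_cmp z (B c).
Proof.
case: z => [|d z]; first by exists true; rewrite /prefix_cmp prefix0s.
rewrite -cat_rcons => Lz; have [c ed] := h_ext (lang_prefix HL Lz).
exists c; rewrite /prefix_cmp B_head /= ed eqxx /= orbC.
have [LB _ nB] := B_return c.
apply: (deterministic_prefix (F := rcons V d)) => //.
- by rewrite size_rcons leqW.
- by rewrite cat_rcons ed -B_head.
- move=> n lt_n; have := nB n.+1; rewrite B_head /= cat_rcons ed.
  by apply; rewrite !ltnS.
Qed.

Lemma return_suffix u : suffix V (V ++ coded B u).
Proof.
elim: u => [|c u /suffixP[y IHu]]; first by rewrite cats0 suffix_refl.
have [_ /suffixP[x ex] _] := B_return c.
by rewrite coded_cons catA ex -catA IHu catA suffix_suffix.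
Qed.

Lemma return_coded z : L (V ++ z) -> suffix V (V ++ z) -> exists u, z = coded B u.
Proof.
have [n] := ubnP (size z); elim: n z => // n IHn z lt_z Lz Vz.
have [/nilP ->|z0] := boolP (nilp z); first by exists [::].
have [c zc] := return_parse Lz; have [_ /suffixP[x ex] nB] := B_return c.
have /prefixP[z' ez] : prefix (B c) z.
  case/orP: zc => // zB; have [le_B|lt_B] := leqP (size (B c)) (size z).
    by rewrite (prefix_eq_size zB) // prefix_refl.
  have := nB (size z); rewrite lt_B andbT lt0n z0 => /(_ isT).
  by case/prefixP: zB Vz => s ->; rewrite take_size_cat // => ->.
have eVz : V ++ z = x ++ (V ++ z') by rewrite ez catA ex catA.
have [|||u eu] := IHn z'.
- by move: lt_z; rewrite ez B_head /= size_cat; clear; lia.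
- by move: Lz; rewrite eVz; apply: lang_suffix.
- apply: suffix_leq_total Vz _ _; first by rewrite eVz suffix_suffix.
  by rewrite size_cat leq_addr.
by exists (c :: u); rewrite ez eu.
Qed.

(** For equal lengths the first letters of the blocks disagree; otherwise [V] would return too early
    inside [V ++ B (~~ c)]. This excludes the first two cases of [suffix_or_diverge]. *)
Lemma return_not_suffix c : ~~ suffix (V ++ B c) (V ++ B (~~ c)).
Proof.
apply/negP => /suffixP[x ex]; have [x0|x0] := posnP (size x).
  move/size0nil: x0 ex => -> /eqP; rewrite /= eqseq_cat // eqxx !B_head /= eqseq_cons.
  by case: (c) hh => /= hc /andP[/eqP e]; rewrite e eqxx in hc.
have [_ _ /(_ (size x))] := B_return (~~ c).
have sx := congr1 size ex; rewrite !size_cat in sx.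
have lt_x : size x < size (B (~~ c)) by move: sx; rewrite [B c]B_head /=; clear; lia.
rewrite x0 lt_x => /(_ isT) /negP; apply.
have -> : V ++ take (size x) (B (~~ c)) = take (size (x ++ V)) (V ++ B (~~ c)).
  by rewrite size_cat addnC take_cat ltnNge leq_addr /= addKn.
by rewrite ex catA take_size_cat // suffix_suffix.
Qed.

Context (W : seq A) (l : bool -> A) (x : bool -> seq A).
Context (ll : l false != l true) (B_last : forall c, V ++ B c = x c ++ l c :: W).

Lemma return_suffix_last : suffix V W.
Proof.
have V0 : suffix V (V ++ B false) by have [] := B_return false.
have V1 : suffix V (V ++ B true) by have [] := B_return true.
by rewrite !B_last in V0 V1; apply: diverging_suffix ll V0 V1.
Qed.

Lemma size_coded_leq u : size (coded B u) <= size u * max_block B.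
Proof.
elim: u => //= c u IHu; rewrite coded_cons size_cat mulSn leq_add //.
exact: leq_max_block.
Qed.

(** Far enough to the left [V] occurs, and from there on return words can be read up to [z]. If [d],
    [c] are the last two, [V ++ B d] ends with [W]. *)
Lemma return_left z : L (V ++ z) -> exists c, L (W ++ B c ++ z).
Proof.
move=> Lz; have LV := lang_prefix HL Lz; have [N HN] := lang_rec HL LV.
pose M := (2 * max_block B).+1.
have [y sy Ly] := lang_leftn HL (N + M) Lz.
have /infixP[y1 [y2 ey]] : infix V (take N y).
  apply: HN; last by rewrite size_takel // sy leq_addr.
  by apply: (lang_prefix HL (v := drop N y ++ V ++ z)); rewrite catA cat_take_drop.
pose s := y2 ++ drop N y ++ V.
have eyV : y ++ V = y1 ++ V ++ s.
  by rewrite -{1}(cat_take_drop N y) ey /s -!catA.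
have Ls : L ((V ++ s) ++ z).
  by apply: (lang_suffix HL (u := y1)); rewrite catA -eyV -catA.
have [u eu] : exists u, s = coded B u.
  apply: return_coded; first exact: lang_prefix Ls.
  by rewrite /s !catA suffix_suffix.
have u3 : 2 < size u.
  have : M <= size s by rewrite /s !size_cat size_drop sy; lia.
  have := size_coded_leq u; rewrite -eu /M => le1 lt1.
  have := leq_trans lt1 le1; rewrite ltn_mul2r; by case/andP.
case/lastP: u u3 eu => // u c; case/lastP: u => // u d _ eu.
exists c; move: Ls; rewrite eu !coded_rcons.
have /suffixP[w ew] := return_suffix u.
have -> : (V ++ (coded B u ++ B d) ++ B c) ++ z =
    (w ++ rcons (x d) (l d)) ++ (W ++ B c ++ z).
  by rewrite -!catA (catA V (coded B u)) ew -!catA (catA V (B d)) B_last -!catA -cats1 -!catA.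
exact: lang_suffix.
Qed.

Lemma return_last : exists y : bool -> seq A,
  forall c, W ++ B c = y c ++ l c :: W.
Proof.
have /suffixP[s es] := return_suffix_last.
by exists (fun c => s ++ x c) => c; rewrite {1}es -catA B_last catA.
Qed.

(** As [W ++ B c] ends with [W], [return_left] allows [V] to be replaced by the longer word [W]. *)
Lemma return_extend z : L (V ++ z) -> L (W ++ z).
Proof.
move=> /return_left[c]; have [y ey] := return_last.
by rewrite catA ey -cat_rcons -catA => /(lang_suffix HL).
Qed.

Lemma coding_return : coding L W B.
Proof.
have /suffixP[s es] := return_suffix_last.
split.
- by exists h, t.
- by have [y ey] := return_last; exists l, y.
- by move=> z; rewrite es -catA => /(lang_suffix HL); apply: return_parse.
- by move=> c; apply: return_extend; have [] := B_return c.
- move=> u; rewrite {1}/codes es -catA => /(lang_suffix HL)/return_left[c Lc].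
  by exists c; rewrite es in Lc.
Qed.

(** The windows starting in the first [size (B c)] positions; counting them bounds the complexity at
    length [(size W).+1] from below. *)
Definition factor_at c i := take (size W).+1 (drop i (W ++ B c)).

Let rest c i := drop (size W).+1 (drop i (W ++ B c)).

Lemma factor_restE c i : factor_at c i ++ rest c i = drop i (W ++ B c).
Proof. exact: cat_take_drop. Qed.

Lemma size_factor_at c i : i < size (B c) -> size (factor_at c i) = (size W).+1.
Proof. by move=> lt_i; rewrite size_takel // size_drop size_cat; lia. Qed.

Lemma size_rest c i : size (rest c i) = size (B c) - i.+1.
Proof. by rewrite !size_drop size_cat; lia. Qed.

Lemma suffix_factor_rest c i : i < size (B c) ->
  suffix (l c :: W) (factor_at c i ++ rest c i).
Proof.
move=> lt_i; rewrite factor_restE; have [y ey] := return_last.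
apply: suffix_leq_total (_ : suffix _ (W ++ B c)) _ _.
- by rewrite ey suffix_suffix.
- by apply/suffixP; exists (take i (W ++ B c)); rewrite cat_take_drop.
- by rewrite size_drop size_cat /=; lia.
Qed.

Lemma factor_rest_lang c i : L (factor_at c i ++ rest c i).
Proof.
rewrite factor_restE; apply: (lang_suffix HL (u := take i (W ++ B c))).
by rewrite cat_take_drop; apply: (coding_word coding_return).
Qed.

Lemma factor_rest_return c i n : i < size (B c) -> n < size (rest c i) ->
  ~~ suffix V (factor_at c i ++ take n (rest c i)).
Proof.
rewrite size_rest => lt_i lt_n; have [_ _ /(_ (i.+1 + n))] := B_return c.
move=> /(_ ltac:(lia)); apply: contra => VF.
have /suffixP[s es] := return_suffix_last.
have F_suffix : suffix (factor_at c i ++ take n (rest c i)) (W ++ take (i.+1 + n) (B c)).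
  rewrite -takeD take_drop (_ : (size W).+1 + n + i = size W + (i.+1 + n)); last by lia.
  rewrite take_cat ltnNge leq_addr /= addKn.
  by apply/suffixP; exists (take i (W ++ take (i.+1 + n) (B c))); rewrite cat_take_drop.
apply: suffix_leq_total (suffix_trans VF F_suffix) _ _.
  by apply/suffixP; exists s; rewrite catA -es.
by rewrite size_cat leq_addr.
Qed.

(** If [rest c i] were shorter, determinism would make it a proper prefix of [rest d j]; but [V]
    recurs at its end, where it must not yet recur in the other block. *)
Lemma factor_rest_prefix c (d : bool) i j : i < size (B c) -> j < size (B d) ->
  factor_at c i = factor_at d j -> size (rest d j) <= size (rest c i).
Proof.
move=> lt_i lt_j eF; rewrite leqNgt; apply/negP => lt_r.
have le_V : size V <= size (factor_at c i).
  rewrite size_factor_at //; have := return_suffix_last => /suffixP[s ->].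
  by rewrite size_cat; lia.
have Lj := factor_rest_lang d j; rewrite -eF in Lj.
have := deterministic_prefix le_V (factor_rest_lang c i) Lj.
move=> /(_ (fun n => factor_rest_return lt_i)) /orP[|]; last first.
  by move/size_prefix; rewrite leqNgt lt_r.
move=> /prefixP[s es]; have /negP := factor_rest_return lt_j lt_r; apply.
rewrite es take_size_cat // -eF.
apply: suffix_trans (suffix_factor_rest lt_i); rewrite -cat1s.
by have /suffixP[y ->] := return_suffix_last; rewrite catA suffix_suffix.
Qed.

(* Such a factor determines the rest of the block up to the return to [V], hence
   its position; the letter [l c] preceding [W] then determines the block. *)
Lemma factor_at_inj c (d : bool) i j : i < size (B c) -> j < size (B d) ->
  factor_at c i = factor_at d j -> c = d /\ i = j.
Proof.
move=> lt_i lt_j eF.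
have er : size (rest c i) = size (rest d j).
  by apply/eqP; rewrite eqn_leq !factor_rest_prefix.
have le_V : size V <= size (factor_at c i).
  rewrite size_factor_at //; have := return_suffix_last => /suffixP[s ->].
  by rewrite size_cat; lia.
have Lj := factor_rest_lang d j; rewrite -eF in Lj.
have := deterministic_prefix le_V (factor_rest_lang c i) Lj.
move=> /(_ (fun n => factor_rest_return lt_i)) /orP rr.
have {}rr : rest c i = rest d j.
  by case: rr => rr; [|apply/esym]; apply: prefix_eq_size rr _; rewrite er.
have cd : c = d.
  apply/eqP; apply: contraTT isT => cd; have := suffix_factor_rest lt_i.
  rewrite eF rr => sc; have sd := suffix_factor_rest lt_j.
  have := suffix_leq_total sc sd (leqnn _); rewrite suffixE /= subnn drop0 => /eqP[].
  by case: (c) (d) ll cd => [] [] // /eqP lne _ e; case: lne; rewrite e.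
split=> //; move: er lt_i lt_j; rewrite !size_rest -cd; lia.
Qed.

Lemma nwords_return : size (B false) + size (B true) <= nwords L (size W).+1.
Proof.
have mk (c : bool) (i : 'I_(size (B c))) : size (factor_at c i) == (size W).+1.
  by rewrite size_factor_at.
pose f (p : 'I_(size (B false)) + 'I_(size (B true))) : (size W).+1.-tuple A :=
  match p with inl i => Tuple (mk false i) | inr i => Tuple (mk true i) end.
have f_inj : injective f.
  move=> [] i [] j /(congr1 val) /=.
  - by case/(factor_at_inj (ltn_ord i) (ltn_ord j)) => _ /val_inj ->.
  - by case/(factor_at_inj (ltn_ord i) (ltn_ord j)).
  - by case/(factor_at_inj (ltn_ord i) (ltn_ord j)).
  - by case/(factor_at_inj (ltn_ord i) (ltn_ord j)) => _ /val_inj ->.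
rewrite -{1}[size (B false)]card_ord -{1}[size (B true)]card_ord -card_sum.
rewrite -(card_imset _ f_inj); apply: subset_leq_card.
apply/fintype.subsetP => w /imsetP[p _ ->].
rewrite finset.inE; apply/asboolP.
have Lf c i : L (factor_at c i) by apply: (lang_prefix HL (factor_rest_lang c i)).
by case: p => i /=.
Qed.
End ReturnWords.

(** As the complexity grows by at most 1, there is only one right special word [V] of length [q],
    with two extensions. Its return words are the blocks, and [W] is the longest common suffix of
    [V ++ B false] and [V ++ B true]. *)
Lemma return_base q : nwords L q.+1 <= (nwords L q).+1 -> exists W B,
  [/\ coding L W B, q <= size W, counted L (size W).+1 (excess W B) W B &
      (size W).+1 + excess W B <= (nwords L (size W).+1).+1].
Proof.
move=> le_q; have [V sV RSV] := lang_special HL q.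
have V_unique z : size z = size V -> right_special L z -> z = V.
  rewrite sV => sz RSz; have : nspecial L q <= 1.
    by have := nwords_special HL q; lia.
  have [tz ez] := seq_tuple sz; have [tV eV] := seq_tuple sV.
  move=> /card_le1_eqP /(_ tz tV); rewrite !finset.inE ez eV => e.
  by rewrite -ez -eV e //; apply/asboolP.
have [a [b [ab La Lb]]] := RSV.
pose h c := if c then b else a.
have Lh c : L (rcons V (h c)) by case: c.
have h_ext d : L (rcons V d) -> exists c, d = h c.
  move=> Ld; have [->|da] := eqVneq d a; first by exists false.
  have [->|db] := eqVneq d b; first by exists true.
  have ab_d : uniq [:: a; b; d] by rewrite /= !finset.inE negb_or ab eq_sym da eq_sym db.
  by have := nwords_three HL sV ab_d La Lb Ld; lia.
have [[r0 R0] [r1 R1]] := (first_return_exists (Lh false), first_return_exists (Lh true)).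
pose t c := if c then r1 else r0; pose B c := h c :: t c.
have BR c : first_return V (B c) by case: c.
have BH c : B c = h c :: t c by [].
have := return_not_suffix (h := h) ab BH BR.
move=> nsuff; have [s|s|[x0 [x1 [l0 [l1 [W [l01 e0 e1]]]]]]] :=
  suffix_or_diverge (V ++ B false) (V ++ B true).
- by have := nsuff false; rewrite s.
- by have := nsuff true; rewrite s.
pose l c := if c then l1 else l0; pose x c := if c then x1 else x0.
have lx c : V ++ B c = x c ++ l c :: W by case: c.
have C : coding L W B.
  exact: (coding_return V_unique (h := h) (t := t) ab h_ext BH BR (l := l) (x := x)).
exists W, B; split=> //.
- have := return_suffix_last BR (l := l) (x := x) l01 lx => /suffixP[s ->].
  by rewrite size_cat sV leq_addl.
(* With [e0] equal to the excess, [counted_off] holds before any other right special word is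
   counted. *)
- by split=> // n _ _; apply: leq_addr.
- have := nwords_return V_unique (h := h) (t := t) ab h_ext BH BR (l := l) (x := x) l01 lx.
  by have := coding_size_lt C; rewrite /excess; lia.
Qed.
End Base.

(** * Contraction of the deviations *)

Section Potential.
Context (A : finType) (L : seq A -> Prop) (HL : recurrent_language L).
Implicit Types (c r : bool) (D : nat) (u v : seq bool) (W : seq A)
  (B : bool -> seq A).

Definition potential W B := minn (3 * excess W B) (2 * min_block B).

Lemma potential_gt0 W B : coding L W B -> 0 < potential W B.
Proof.
move=> C; have := excess_gt0 C; have := coding_size_gt0 C false.
have := coding_size_gt0 C true; rewrite /potential /min_block; lia.
Qed.

Lemma potential_step W B r D : coding L W B -> stepping L W B r D ->
  potential W B <= potential (W ++ B (~~ r)) (step_code B r D).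
Proof.
move=> C S; rewrite /potential (excess_step C S) min_block_step (min_block_sym _ r).
move: (_.-1 * _); lia.
Qed.

Context (K Q0 Q e0 : nat) (K_gt0 : 0 < K).
Context (complexity_leq : forall q m, Q0 <= q -> q + m <= nwords L q.+1 ->
  K.*2.+1 * m <= K * q).
Context (lt_Q0 : Q0 < Q) (nwords_base : Q + e0 <= (nwords L Q).+1).

(** The gain factor is [1 + 1 / (4 K)]. For the potential [P], [e >= P / 3] and [a >= P / 2] bound
    the new excess [e + (D - 1) a] directly, and [b] through [step_constraint]. *)
Lemma potential_step_gain W B r D : coding L W B -> counted L Q e0 W B ->
  stepping L W B r D -> 1 < D ->
  (4 * K).+1 * (D * potential W B) <=
    4 * K * potential (W ++ B (~~ r)) (step_code B r D).
Proof.
move=> C HC S D2.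
have := step_constraint HL complexity_leq lt_Q0 nwords_base C HC S D2.
rewrite /potential (excess_step C S) min_block_step (min_block_sym _ r).
move: (excess W B) (size (B r)) (size (B (~~ r))) => e a b.
set P := minn _ _; have [P1 P2 P3] : [/\ P <= 3 * e, P <= 2 * a & P <= 2 * b].
  by split; rewrite /P; lia.
have [d ->] : exists d, D = d.+2 by exists (D - 2); lia.
rewrite !subSS subn0 /= => le_b.
have le_P1 : (2 * K) * P <= (2 * K) * (3 * e) by rewrite leq_mul2l P1 orbT.
rewrite minnMr leq_min; apply/andP; split.
- have : (6 * K * d.+1) * P <= (6 * K * d.+1) * (2 * a) by rewrite leq_mul2l P2 orbT.
  have : d * P <= K * d * P by rewrite leq_mul2r leq_pmull ?orbT.
  have : P <= K * P by rewrite leq_pmull.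
  move: le_P1; clear; lia.
- have : (4 * (K * d + d.+1)) * P <= (4 * (K * d + d.+1)) * (2 * a).
    by rewrite leq_mul2l P2 orbT.
  have : d * P <= d * P by [].
  move: le_P1 le_b P1; clear; lia.
Qed.

End Potential.

Local Open Scope ring_scope.

(** * Inequalities in an ordered field and weights of block sequences *)

Section Discrepancy.
Context (R : realFieldType).

(** The terms [p * b] and [- q * a] have the same sign. This is used for the determinant and, with
    [a = b = 1], for the difference of two deviations. *)
Lemma opposite_sign (p q a b : R) : p * q <= 0 -> 0 <= a -> 0 <= b ->
  `|p * b - q * a| = `|p| * b + `|q| * a.
Proof.
move=> pq a0 b0.
have [/eqP|pq0] := eqVneq (p * q) 0.
  rewrite mulf_eq0 => /orP[] /eqP ->; rewrite normr0 !mul0r ?add0r ?addr0 ?sub0r ?subr0.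
    by rewrite normrN normrM (ger0_norm a0).
  by rewrite normrM (ger0_norm b0).
have {pq pq0} pq : p * q < 0 by rewrite lt_neqAle pq0.
case/orP: (le_total 0 p) => p0.
  have q0 : q <= 0 by nra.
  by rewrite (ger0_norm p0) (ler0_norm q0) ger0_norm; nra.
have q0 : 0 <= q by nra.
by rewrite (ler0_norm p0) (ger0_norm q0) ler0_norm; nra.
Qed.

(** Carries the opposite signs of the new deviations [p] and [d * s + p] back to the old ones, [s]
    and [p]: the product contains the square of [p]. *)
Lemma opposite_sign_step (p s d : R) : 0 < d -> p * (d * s + p) <= 0 -> s * p <= 0.
Proof.
move=> d0; rewrite mulrDr mulrCA -expr2 => le0; rewrite -(pmulr_rle0 _ d0) [s * p]mulrC.
by apply: le_trans le0; rewrite lerDl sqr_ge0.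
Qed.

Lemma sum_norm_leq (p0 p1 s0 s1 phi t : R) : 0 <= p0 -> 0 <= p1 -> 0 < phi ->
  phi <= 2 * s0 -> phi <= 2 * s1 -> t * phi = p0 * s1 + p1 * s0 ->
  p0 + p1 <= 2 * t.
Proof.
move=> p0_ge0 p1_ge0 phi0 le0 le1 te; rewrite -(ler_pM2r phi0) -[2 * t * _]mulrA te.
have := ler_wpM2l p0_ge0 le1; have := ler_wpM2l p1_ge0 le0; lra.
Qed.

(** Here [t] and [t'] are the determinant divided by the potential, before and after a step with
    [D = m]. *)
Lemma ratio_gain (k t t' p p' d m : R) : 0 < p -> 0 < p' -> 0 <= d ->
  t * p = d -> t' * p' = m * d -> (4 * k + 1) * (m * p) <= 4 * k * p' ->
  (4 * k + 1) * t' <= 4 * k * t.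
Proof.
move=> p0 p'0 d0 te te' /(ler_wpM2r d0) le_d.
rewrite -(ler_pM2r p0) -(ler_pM2r p'0).
have -> : (4 * k + 1) * t' * p * p' = (4 * k + 1) * p * (t' * p') by ring.
have -> : 4 * k * t * p * p' = 4 * k * (t * p) * p' by ring.
by rewrite te te'; lra.
Qed.

(** The errors add up to at most [5 m <= 10 t'], and the gain makes [40 k t] at least
    [40 k t' + 10 t']; hence the constant 40. *)
Lemma norm_sum_gain (k t t' m wj wo w wi s : R) :
  (4 * k + 1) * t' <= 4 * k * t -> m <= 2 * t' ->
  `|wj| <= m -> `|wo| <= m -> `|wi| <= m -> `|w| <= 2 * m + 40 * k * t' -> 0 <= s ->
  `|wj + (wo + (w + wi))| <= 2 * s + 40 * k * t.
Proof.
move=> gain le_m le_j le_o le_i le_w s0.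
apply: le_trans (ler_normD _ _) _; have := ler_normD wo (w + wi).
have := ler_normD w wi; lra.
Qed.

(** The difference [2 so] between the two first terms pays for [a] and [b]. *)
Lemma norm_sum_neutral (k t t' s so w a b : R) : 0 <= k -> t' <= t ->
  `|a| <= so -> `|b| <= so -> `|w| <= 2 * s + 40 * k * t' ->
  `|a + w - b| <= 2 * (s + so) + 40 * k * t.
Proof.
move=> k0 le_t le_a le_b le_w; have := ler_normB (a + w) b; have := ler_normD a w.
have : 40 * k * t' <= 40 * k * t by rewrite ler_wpM2l // mulr_ge0.
lra.
Qed.

Definition weight (x : bool -> R) (u : seq bool) : R := \sum_(c <- u) x c.

Lemma weight_cat x u v : weight x (u ++ v) = weight x u + weight x v.
Proof. exact: big_cat. Qed.

Lemma weight_cons x c u : weight x (c :: u) = x c + weight x u.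
Proof. exact: big_cons. Qed.

Lemma weight_seq1 x c : weight x [:: c] = x c.
Proof. exact: big_seq1. Qed.

Lemma weight_nseq x n c : weight x (nseq n c) = n%:R * x c.
Proof.
elim: n => [|n IHn]; first by rewrite /weight big_nil mul0r.
by rewrite /= weight_cons IHn -natr1; ring.
Qed.

Lemma weight_step x r D c :
  weight x (step_word r D c) = (if c then D else 0)%:R * x r + x (~~ r).
Proof. by rewrite /step_word -cats1 weight_cat weight_nseq weight_seq1. Qed.

Lemma weight_coded_step x r D u :
  weight x (coded (step_word r D) u) = weight (fun c => weight x (step_word r D c)) u.
Proof.
elim: u => [|c u IHu]; first by rewrite /weight !big_nil.
by rewrite coded_cons weight_cat weight_cons IHu.
Qed.

(** * Induction along the steps *)

Section Induction.
Context (A : finType) (L : seq A -> Prop) (HL : recurrent_language L).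
Context (K Q0 Q e0 : nat) (K_gt0 : (0 < K)%N).
Context (complexity_leq : forall q m, (Q0 <= q)%N -> (q + m <= nwords L q.+1)%N ->
  (K.*2.+1 * m <= K * q)%N).
Context (lt_Q0 : (Q0 < Q)%N) (nwords_base : (Q + e0 <= (nwords L Q).+1)%N).
Implicit Types (c r : bool) (D : nat) (u v : seq bool) (W : seq A)
  (B : bool -> seq A) (x : bool -> R) (rho : R).

Definition deviation x rho B c : R := x c - rho * (size (B c))%:R.

Definition det_blocks x B : R :=
  `|x false * (size (B true))%:R - x true * (size (B false))%:R|.

Definition disc_bound W B x rho : R :=
  2 * (`|deviation x rho B false| + `|deviation x rho B true|) +
  (40 * K)%:R * (det_blocks x B / (potential W B)%:R).

Definition step_weight r D x c : R := weight x (step_word r D c).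

Lemma deviation_step x rho B r D c :
  deviation (step_weight r D x) rho (step_code B r D) c =
    weight (deviation x rho B) (step_word r D c).
Proof.
rewrite /deviation /step_weight !weight_step size_step_code natrD natrM.
by case: c; ring.
Qed.

Lemma det_blocks_sym x B r : det_blocks x B =
  `|x r * (size (B (~~ r)))%:R - x (~~ r) * (size (B r))%:R|.
Proof. by rewrite /det_blocks; case: r => //=; rewrite distrC. Qed.

Lemma det_blocks_step x B r D :
  det_blocks (step_weight r D x) (step_code B r D) = D%:R * det_blocks x B.
Proof.
rewrite (det_blocks_sym x B r) /det_blocks /step_weight !weight_step.
rewrite !size_step_code mul0n !natrD natrM -[in RHS](normr_nat R D) -normrM -normrN.
by congr `|_|; rewrite mul0r; ring.
Qed.

Lemma weight_run_leq x r D j : (j <= D)%N ->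
  `|weight x (nseq j r)| <= D%:R * `|x r|.
Proof.
by move=> le_jD; rewrite weight_nseq normrM normr_nat ler_wpM2r // ler_nat.
Qed.

Lemma size_coded_step r D u : (size u <= size (coded (step_word r D) u))%N.
Proof.
elim: u => //= c u IHu; rewrite coded_cons size_cat /step_word size_rcons addSn ltnS.
exact: leq_trans IHu (leq_addl _ _).
Qed.

(* Induction on the length of the block sequence, through one step. For [D = 1] the
   sum of the absolute deviations drops by exactly that of the block [~~ r], which
   pays for completing the sequence at both ends; for [D > 1] all errors are
   absorbed by the decrease of the second term of [disc_bound]. *)
Lemma weight_bounded N W B x : coding L W B -> counted L Q e0 W B ->
  exists2 rho : R, deviation x rho B false * deviation x rho B true <= 0 &
    forall u, (size u <= N)%N -> codes L W B u ->
      `|weight (deviation x rho B) u| <= disc_bound W B x rho.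
Proof.
have bound_ge0 W1 B1 x1 (rho1 : R) : 0 <= disc_bound W1 B1 x1 rho1.
  by rewrite /disc_bound addr_ge0 // mulr_ge0 // ?addr_ge0 // divr_ge0 // /det_blocks.
elim: N W B x => [|N IHN] W B x C HC.
  (* Only the empty sequence has to be bounded; this [rho] makes the first deviation vanish. *)
  exists (x false / (size (B false))%:R).
    rewrite {1}/deviation divfK ?subrr ?mul0r // pnatr_eq0 -lt0n.
    exact: coding_size_gt0 C _.
  by case=> // _ _; rewrite /weight big_nil normr0.
have [r [D S]] := stepping_exists HL complexity_leq lt_Q0 nwords_base C HC.
have C' := coding_step HL C S; have HC' := counted_step HL C HC S.
have [rho sgn' IH] := IHN _ _ (step_weight r D x) C' HC'.
set f := deviation x rho B; set f' := deviation _ rho _ in sgn'.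
have f'E c : f' c = (if c then D else 0)%:R * f r + f (~~ r).
  by rewrite /f' deviation_step weight_step.
have weightE u : weight f (coded (step_word r D) u) = weight f' u.
  by rewrite weight_coded_step; congr weight; apply/funext => c; rewrite f'E weight_step.
have sgn_step : f (~~ r) * (D%:R * f r + f (~~ r)) <= 0.
  by move: sgn'; rewrite !f'E mul0r add0r.
have D1 : 1 <= D%:R :> R by rewrite ler1n (stepping_gt0 S).
have sgn : f false * f true <= 0.
  have := opposite_sign_step (lt_le_trans ltr01 D1) sgn_step.
  by case: (r) => //; rewrite mulrC.
exists rho => //.
(* The new deviations have opposite signs and differ by [D%:R * f r]. *)
have normD : `|f' false| + `|f' true| = D%:R * `|f r|.
  have := opposite_sign sgn' ler01 ler01; rewrite !mulr1 => <-.
  rewrite !f'E mul0r add0r opprD addrCA subrr addr0 normrN normrM.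
  by rewrite normr_nat.
have normS : `|f false| + `|f true| = `|f r| + `|f (~~ r)|.
  by case: (r) => //=; rewrite addrC.
pose T : R := det_blocks x B / (potential W B)%:R.
pose T' : R := det_blocks (step_weight r D x) (step_code B r D) /
  (potential (W ++ B (~~ r)) (step_code B r D))%:R.
have T'0 : 0 <= T' by rewrite divr_ge0 // /det_blocks.
have boundE : disc_bound W B x rho =
    2 * (`|f false| + `|f true|) + (40 * K)%:R * T by [].
have bound'E : disc_bound (W ++ B (~~ r)) (step_code B r D) (step_weight r D x) rho =
    2 * (D%:R * `|f r|) + (40 * K)%:R * T' by rewrite -normD.
have phi0 : 0 < (potential W B)%:R :> R by rewrite ltr0n (potential_gt0 C).
have phi'0 : 0 < (potential (W ++ B (~~ r)) (step_code B r D))%:R :> R.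
  by rewrite ltr0n (potential_gt0 C').
have det'E : det_blocks (step_weight r D x) (step_code B r D) =
    `|f' false| * (size (step_code B r D true))%:R +
    `|f' true| * (size (step_code B r D false))%:R.
  rewrite -opposite_sign //; congr `|_|; rewrite /f' /deviation; ring.
have det0 : 0 <= det_blocks x B by rewrite /det_blocks.
have det'D := det_blocks_step x B r D.
have T'E : T' * (potential (W ++ B (~~ r)) (step_code B r D))%:R = D%:R * det_blocks x B.
  by rewrite /T' divfK ?det'D // gt_eqF.
have TE : T * (potential W B)%:R = det_blocks x B by rewrite /T divfK // gt_eqF.
have T0 : 0 <= T by rewrite divr_ge0.
have wr j : codes L W B (nseq j r) -> `|weight f (nseq j r)| <= D%:R * `|f r|.
  by move=> /(codes_run HL C S); apply: weight_run_leq.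
have fo : `|f (~~ r)| <= D%:R * `|f r|.
  by rewrite -normD (f'E false) mul0r add0r lerDl.
have natK n : (n * K)%:R = n%:R * K%:R :> R by rewrite natrM.
move=> u le_u Yu; rewrite boundE normS natK; rewrite natK in bound'E.
have [D2|D_le1] := ltnP 1 D.
  have omega' : D%:R * `|f r| <= 2 * T'.
    rewrite -normD; apply: (sum_norm_leq (s0 := (size (step_code B r D false))%:R)
      (s1 := (size (step_code B r D true))%:R) _ _ phi'0) => //.
    - by rewrite -natrM ler_nat /potential /min_block; clear; lia.
    - by rewrite -natrM ler_nat /potential /min_block; clear; lia.
    - by rewrite T'E -det'D det'E.
  have gain : (4 * K%:R + 1) * T' <= 4 * K%:R * T.
    apply: ratio_gain phi0 phi'0 det0 TE T'E _.
    have := potential_step_gain HL K_gt0 complexity_leq lt_Q0 nwords_base C HC S D2.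
    by rewrite -(ler_nat R) !natrM -[(4 * K).+1%:R]natr1 natrM.
  (* [u] is a run of [r], or a run, one [~~ r], a sequence of new blocks and an unfinished run;
     these four parts are the summands of [norm_sum_gain]. *)
  have [eu|[j [v eu]]] := run_split r u.
    have := norm_sum_gain (wj := weight f u) (wo := 0) (w := 0) (wi := 0) gain omega'.
    rewrite !addr0 normr0; apply.
    + by rewrite eu; apply: wr; rewrite -eu.
    + exact: le_trans (normr_ge0 _) fo.
    + exact: le_trans (normr_ge0 _) fo.
    + by rewrite -bound'E.
    + by rewrite addr_ge0.
  have Yj : codes L W B (nseq j r).
    by apply: (codes_prefix HL C (v := ~~ r :: v)); rewrite -eu.
  have [|u' [i [ev le_i Yu']]] := step_parse HL C S (v := v).
    by apply: (codes_suffix HL C (u := nseq j r)); rewrite -eu.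
  rewrite eu weight_cat weight_cons ev weight_cat weightE.
  apply: norm_sum_gain gain omega' _ _ _ _ _ => //.
  + exact: wr.
  + exact: weight_run_leq.
  + rewrite -bound'E; apply: IH => //; rewrite -ltnS; apply: leq_trans le_u.
    rewrite eu ev size_cat /= size_cat ltn_addl // ltnS.
    exact: leq_trans (size_coded_step r D u') (leq_addr _ _).
have eD : D = 1%N by apply/eqP; rewrite eqn_leq D_le1 (stepping_gt0 S).
have D1E : D%:R = 1 :> R by rewrite eD.
have le_T : T' <= T.
  rewrite -(ler_pM2r phi'0) T'E D1E mul1r -TE ler_wpM2l // ler_nat.
  exact: (potential_step C S).
rewrite D1E mul1r in wr bound'E.
have neutral w a b : codes L (W ++ B (~~ r)) (step_code B r D) w -> (size w <= N)%N ->
    `|a| <= `|f (~~ r)| -> `|b| <= `|f (~~ r)| -> weight f u = a + weight f' w - b ->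
    `|weight f u| <= 2 * (`|f r| + `|f (~~ r)|) + 40 * K%:R * T.
  move=> Yw le_w le_a le_b ->; apply: norm_sum_neutral le_T le_a le_b _ => //.
  by rewrite -bound'E; apply: IH.
have short j : codes L W B (nseq j r) -> (j <= 1)%N.
  by move=> /(codes_run HL C S); rewrite eD.
have [eu|[j [v eu]]] := run_split r u.
  have Yr : codes L W B (nseq (size u) r) by rewrite -eu.
  rewrite eu; apply: le_trans (wr _ Yr) _.
  have T40 : 0 <= 40 * K%:R * T by apply: mulr_ge0 => //; apply: mulr_ge0.
  apply: ler_wpDr T40 _; rewrite mulrDr mulr_natl mulr2n -addrA lerDl.
  by rewrite addr_ge0 // mulr_ge0.
have [u' [i [ev le_i Yu']]] : exists u' i, [/\ v = coded (step_word r D) u' ++ nseq i r,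
    (i <= D)%N & codes L (W ++ B (~~ r)) (step_code B r D) u'].
  apply: (step_parse HL C S (v := v)).
  by apply: (codes_suffix HL C (u := nseq j r)); rewrite -eu.
(* An unfinished [r] on the right is completed to a new block by [~~ r], as the square of [r] does
   not occur; the added weight is subtracted as [b]. *)
have [w [b [Yw sw le_b wv]]] : exists w b, [/\
    codes L W B (nseq j r ++ ~~ r :: coded (step_word r D) w), (size w <= size v)%N,
    `|b| <= `|f (~~ r)| & weight f v = weight f' w - b].
  have stepE : step_word r D true = [:: r; ~~ r] by rewrite eD.
  have sv := size_coded_step r D u'.
  have v_weight : weight f v = weight f' u' + i%:R * f r.
    by rewrite ev weight_cat weightE weight_nseq.
  have [i0|i0] := posnP i.
    exists u', 0; split=> //.
    - by move: Yu; rewrite eu ev i0 cats0.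
    - by rewrite ev size_cat (leq_trans sv) ?leq_addr.
    - by rewrite normr0.
    - by rewrite v_weight i0 mul0r addr0 subr0.
  have i1 : i = 1%N by apply/eqP; rewrite eqn_leq i0 -{1}eD le_i.
  have [[|d [|]] // _ Yd] := codes_rightn HL C 1 Yu.
  have {Yd}Yo : codes L W B (u ++ [:: ~~ r]).
    have [dr|] := eqVneq d r; last by case: (d) (r) Yd => [] [].
    have : codes L W B (nseq 2 r).
      apply: (codes_suffix HL C (u := nseq j r ++ ~~ r :: coded (step_word r D) u')).
      by move: Yd; rewrite eu ev i1 dr -!catA /= -catA.
    by move/short.
  have coded_w : coded (step_word r D) (rcons u' true) =
      coded (step_word r D) u' ++ [:: r; ~~ r] by rewrite coded_rcons stepE.
  exists (rcons u' true), (f (~~ r)); split=> //.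
  - by move: Yo; rewrite coded_w eu ev i1 -!catA /= -catA.
  - by rewrite ev size_rcons size_cat size_nseq i1 addn1 ltnS.
  - by rewrite v_weight i1 -cats1 weight_cat weight_seq1 f'E eD; ring.
have su : (size v < size u)%N by rewrite eu size_cat /= addnS ltnS leq_addl.
have lt_w : (size w < size u)%N by exact: leq_ltn_trans su.
have Yj : codes L W B (nseq j r).
  by apply: (codes_prefix HL C (v := ~~ r :: v)); rewrite -eu.
(* A leading [r] is preceded by [~~ r], so it opens one more new block. Otherwise the leading [~~ r]
   belongs to the context of the new blocks, and its weight is the error [a]. *)
have := short j Yj; rewrite leq_eqVlt ltnS leqn0 => /orP[] /eqP ej.
- have [d Yd] := coding_left C Yw.
  apply: (neutral (true :: w) 0 b).
  + apply/codes_step; rewrite coded_cons {1}eD.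
    have [dr|] := eqVneq d r; last by move: Yd; rewrite ej; case: (d) (r) => [] [].
    have : codes L W B (nseq 2 r).
      apply: (codes_prefix HL C (v := ~~ r :: coded (step_word r D) w)).
      by move: Yd; rewrite ej dr.
    by move/short.
  + rewrite -ltnS; apply: leq_trans le_u; rewrite eu ej /= !ltnS.
    exact: sw.
  + by rewrite normr0.
  + exact: le_b.
  + by rewrite eu ej /= !weight_cons wv f'E eD; ring.
- apply: (neutral w (f (~~ r)) b) => //.
  + by apply/codes_step; move: Yw; rewrite ej.
  + by rewrite -ltnS; apply: leq_trans le_u.
  + by rewrite eu ej /= weight_cons wv addrA.
Qed.
End Induction.
End Discrepancy.

(** * Balance *)

Section Occurrences.
Local Open Scope nat_scope.
Context (A : finType).
Implicit Types (v w x y s t : seq A).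

Lemma occurrences_cons v a w :
  occurrences v (a :: w) = prefix v (a :: w) + occurrences v w.
Proof.
rewrite /occurrences.
have -> : iota 0 (size (a :: w)).+1 = 0 :: iota (1 + 0) (size w).+1 by [].
rewrite iotaDl -(cat1s 0) count_cat count_map; congr (_ + _).
by rewrite /= addn0.
Qed.

Lemma prefix_catl v s t : size v <= size s -> prefix v (s ++ t) = prefix v s.
Proof. by move=> le_v; rewrite !prefixE takel_cat. Qed.

(** An occurrence starting in [x] ends within [x ++ s], since [v] has at most one letter more than
    [s]; all others lie in [s ++ t]. *)
Lemma occurrences_glue v x s t : size v <= (size s).+1 ->
  occurrences v (x ++ s ++ t) + occurrences v s =
  occurrences v (x ++ s) + occurrences v (s ++ t).
Proof.
move=> le_v; elim: x => [|a x IHx]; first by rewrite !cat0s addnC.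
rewrite !cat_cons !occurrences_cons -[LHS]addnA -[RHS]addnA IHx; congr (nat_of_bool _ + _).
rewrite -!cat_cons catA prefix_catl // size_cat /=.
by rewrite (leq_trans le_v) // addSn ltnS leq_addl.
Qed.

Lemma occurrences_leq v w : occurrences v w <= (size w).+1.
Proof. by rewrite /occurrences (leq_trans (count_size _ _)) ?size_iota. Qed.

Lemma occurrences_catl v x s :
  occurrences v s <= occurrences v (x ++ s) <= size x + occurrences v s.
Proof.
elim: x => [|a x /andP[IH1 IH2]]; first by rewrite cat0s add0n leqnn.
rewrite cat_cons occurrences_cons; have -> : size (a :: x) = (size x).+1 by [].
by case: (prefix _ _); lia.
Qed.

End Occurrences.

Section Balance.
Local Open Scope nat_scope.
Context (A : finType) (L : seq A -> Prop) (HL : recurrent_language L).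

Section Coded.
Context (W : seq A) (B : bool -> seq A) (C : coding L W B).

Lemma coding_parse_all y : L (W ++ y) -> exists u r,
  [/\ y = coded B u ++ r, size r <= max_block B & codes L W B u].
Proof.
move=> Ly; suff [u [r [ey sr]]] : exists u r, y = coded B u ++ r /\ size r <= max_block B.
  exists u, r; split=> //; apply: (lang_prefix HL (v := r)); by rewrite -catA -ey.
have [n] := ubnP (size y); elim: n y Ly => // n IHn y Ly lt_y.
have [le_y|lt_M] := leqP (size y) (max_block B); first by exists [::], y.
have [c /prefixP[y' ey]] := coding_read HL C (u := [::]) Ly (ltnW lt_M).
have [||u [r [ey' sr]]] := IHn y'.
- have [l [x [_ lx]]] := coding_last C; move: Ly; rewrite ey catA lx -cat_rcons -catA.
  exact: lang_suffix.
- by move: lt_y; rewrite ey size_cat; have := coding_size_gt0 C c; lia.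
by exists (c :: u), r; split=> //; rewrite ey ey' coded_cons catA.
Qed.

(** By recurrence [W] occurs among the first [N] letters; the word is parsed into blocks from
    there. *)
Lemma language_split : exists N, forall w, L w -> N <= size w ->
  exists x u r, [/\ w = x ++ W ++ coded B u ++ r, size x <= N,
    size r <= max_block B & codes L W B u].
Proof.
have LW : L W by have := codes_nil HL C; rewrite /codes cats0.
have [N HN] := lang_rec HL LW; exists N => w Lw le_N.
have /infixP[x [y exy]] : infix W (take N w).
  apply: HN; last by rewrite size_takel.
  by apply: (lang_prefix HL (v := drop N w)); rewrite cat_take_drop.
have ew : w = x ++ W ++ y ++ drop N w by rewrite -{1}(cat_take_drop N w) exy -!catA.
have [|u [r [ey sr Yu]]] := coding_parse_all (y := y ++ drop N w).
  by apply: (lang_suffix HL (u := x)); rewrite -ew.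
exists x, u, r; split=> //; first by rewrite -ey.
by rewrite -(size_takel le_N) exy size_cat leq_addr.
Qed.

Context (v : seq A).

Local Open Scope ring_scope.

(** The occurrences of [v] in [W ++ B c] that are not contained in [W]: the numbers [n0], [n1] of
    the overview. *)
Definition block_occurrences c : rat :=
  (occurrences v (W ++ B c))%:R - (occurrences v W)%:R.

Lemma block_occurrences_bounds c :
  0 <= block_occurrences c <= (size (B c))%:R.
Proof.
have [l [x [_ lx]]] := coding_last C.
have sB : size (B c) = size (rcons (x c) (l c)).
  by have := congr1 size (lx c); rewrite !size_cat /= size_rcons; lia.
rewrite /block_occurrences lx -cat_rcons sB.
have /andP[le1 le2] := occurrences_catl v (rcons (x c) (l c)) W.
by rewrite subr_ge0 ler_nat le1 /= lerBlDr -natrD ler_nat.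
Qed.

(** Both deviations would be positive for [rho < 0] and negative for [rho > 1]. *)
Lemma deviation_bounds rho :
  deviation block_occurrences rho B false * deviation block_occurrences rho B true <= 0 ->
  0 <= rho <= 1.
Proof.
have a0 c : 0 < (size (B c))%:R :> rat by rewrite ltr0n (coding_size_gt0 C).
have := block_occurrences_bounds false; have := block_occurrences_bounds true.
rewrite /deviation; move: (a0 false) (a0 true).
move: (block_occurrences false) (block_occurrences true).
move: (size (B false))%:R (size (B true))%:R => a b x y a_gt0 b_gt0 /andP[y0 yb] /andP[x0 xa].
move=> sgn; apply/andP; split; rewrite leNgt; apply/negP => rho_lt; move: sgn; apply/negP;
    rewrite -ltNge.
  by apply: mulr_gt0; rewrite subr_gt0; [apply: lt_le_trans x0 | apply: lt_le_trans y0];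
    rewrite nmulr_rlt0.
rewrite nmulr_rgt0 subr_lt0; [apply: le_lt_trans yb _ | apply: le_lt_trans xa _];
  by rewrite ltr_pMl.
Qed.

Context (le_v : (size v <= size W)%N).

Lemma occurrences_coded u :
  (occurrences v (W ++ coded B u))%:R =
  (occurrences v W)%:R + weight block_occurrences u :> rat.
Proof.
elim: u => [|c u IHu]; first by rewrite cats0 /weight big_nil addr0.
have [l [x [_ lx]]] := coding_last C.
rewrite weight_cons addrCA -IHu /block_occurrences.
have := @occurrences_glue _ v (rcons (x c) (l c)) W (coded B u) (leqW le_v).
rewrite !cat_rcons -lx coded_cons (catA W) lx -[in RHS]cat_rcons -catA cat_rcons.
move=> /(congr1 (fun n => n%:R : rat)); rewrite !natrD; lra.
Qed.

Lemma weight_deviation x rho u : weight (deviation x rho B) u =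
  weight x u - rho * (size (coded B u))%:R :> rat.
Proof.
elim: u => [|c u IHu]; first by rewrite /weight !big_nil mulr0 subr0.
by rewrite !weight_cons IHu coded_cons size_cat natrD /deviation; ring.
Qed.

(** The [rho] of [weight_bounded] depends on the length considered, so a bound free of [rho] is
    required. Blocks have length at least 1, so the determinant bounds the deviations. *)
Lemma disc_bound_uniform K x rho :
  deviation x rho B false * deviation x rho B true <= 0 ->
  disc_bound K W B x rho <=
    2 * det_blocks x B + (40 * K)%:R * (det_blocks x B / (potential W B)%:R) :> rat.
Proof.
move=> sgn; rewrite /disc_bound lerD2r ler_wpM2l //.
have -> : det_blocks x B = `|deviation x rho B false| * (size (B true))%:R +
    `|deviation x rho B true| * (size (B false))%:R.
  by rewrite -opposite_sign //; congr `|_|; rewrite /deviation; ring.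
by rewrite lerD // ler_peMr // ler1n (coding_size_gt0 C).
Qed.

Lemma occurrences_deviation N M S w rho : L w ->
  0 <= rho <= 1 ->
  (forall u, (size u <= size w)%N -> codes L W B u ->
     `|weight (deviation block_occurrences rho B) u| <= S) ->
  (exists x u r, [/\ w = x ++ W ++ coded B u ++ r, (size x <= N)%N,
    (size r <= M)%N & codes L W B u]) ->
  `|(occurrences v w)%:R - rho * (size w)%:R| <= S + (N + size W + M).+1%:R.
Proof.
move=> Lw /andP[rho0 rho1] HS [x [u [r [ew sx sr Yu]]]].
have le_u : (size u <= size w)%N.
  rewrite ew !size_cat (leq_trans (_ : _ <= size (coded B u))%N) //; last by lia.
  elim: (u) => //= c u' IHu; rewrite coded_cons size_cat.
  by have := coding_size_gt0 C c; lia.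
have := HS u le_u Yu; rewrite weight_deviation.
have /suffixP[z ez] := coding_suffix C u.
have le_v1 : (size v <= (size W).+1)%N by apply: leqW.
(* [w] is split at its displayed [W] in [h1], and at the [W] that ends [W ++ coded B u] in [h2]. *)
have h1 := occurrences_glue x (coded B u ++ r) le_v1.
have h2 := occurrences_glue z r le_v1.
rewrite catA -ez -catA in h2; rewrite -ew in h1.
have /andP[b1 b2] := occurrences_catl v x W.
have b3 := occurrences_leq v (W ++ r).
have h3 := occurrences_coded u.
have sw : size w = (size x + size W + size r + size (coded B u))%N.
  by rewrite ew !size_cat; lia.
have e1 : (occurrences v w)%:R = (occurrences v (x ++ W))%:R - (occurrences v W)%:R +
    weight block_occurrences u + (occurrences v (W ++ r))%:R :> rat.
  move: h1 h2 h3; move: (occurrences v w) (occurrences v W) (occurrences v (x ++ W))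
    (occurrences v (W ++ coded B u)) (occurrences v (W ++ r))
    (occurrences v (W ++ coded B u ++ r)) => nw nW nx nu nr nur h1 h2 h3.
  have := congr1 (GRing.natmul (1 : rat)) h1; have := congr1 (GRing.natmul (1 : rat)) h2.
  by rewrite !natrD h3; lra.
pose s : rat := (size x + size W + size r)%:R.
have rs0 : 0 <= rho * s by rewrite mulr_ge0.
have rs1 : rho * s <= s by rewrite ler_piMl.
have s_le : s <= (N + size W + M)%:R by rewrite ler_nat; lia.
have d0 : 0 <= (occurrences v (x ++ W))%:R - (occurrences v W)%:R :> rat.
  by rewrite subr_ge0 ler_nat.
have d1 : (occurrences v (x ++ W))%:R - (occurrences v W)%:R + (occurrences v (W ++ r))%:R
    <= (N + size W + M).+1%:R :> rat.
  rewrite -addrAC -natrD lerBlDr -natrD ler_nat; move: b3; rewrite size_cat; lia.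
have d2 : 0 <= (occurrences v (W ++ r))%:R :> rat by [].
have -> : rho * (size w)%:R = rho * s + rho * (size (coded B u))%:R.
  by rewrite sw natrD mulrDr.
move: rs0 rs1 s_le d0 d1 d2; rewrite e1 -natr1 !ler_norml => *.
lra.
Qed.
End Coded.

Context (K Q0 : nat) (K_gt0 : 0 < K).
Context (complexity_leq : forall q m, Q0 <= q -> q + m <= nwords L q.+1 ->
  K.*2.+1 * m <= K * q).

(** Otherwise the complexity grows by at least 2 at every large length, so its ratio to the length
    approaches 2 or more. *)
Lemma nwords_succ_leq q1 : exists2 q, q1 <= q & nwords L q.+1 <= (nwords L q).+1.
Proof.
apply: contrapT => nq; have grow q : q1 <= q -> (nwords L q).+2 <= nwords L q.+1.
  by move=> le_q; rewrite ltnNge; apply/negP => le_n; apply: nq; exists q.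
pose q2 := q1 + Q0.
have big n : n.*2 <= nwords L (q2 + n).
  elim: n => // n IHn; rewrite addnS; apply: leq_trans (grow _ _); last by lia.
  by rewrite doubleS !ltnS.
(* For [q = 5 q2] and [m = 3 q2 + 2], [q + m] is twice [4 q2 + 1], a lower bound for the complexity
   at [q.+1], while [m] exceeds [q / 2]. *)
have := @complexity_leq (q2 + 4 * q2) (3 * q2 + 2) ltac:(lia).
have := big (4 * q2).+1; rewrite addnS => le_n /(_ ltac:(lia)).
have := leq_pmull (3 * q2 + 2) K_gt0; lia.
Qed.

Local Open Scope ring_scope.

Theorem low_complexity_balanced v : exists C : nat, forall w w', L w -> L w' ->
  size w = size w' -> (occurrences v w <= occurrences v w' + C)%N.
Proof.
(* The maximum makes [W] at least as long as [v], as [occurrences_coded] requires. *)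
have [q le_q nq] := nwords_succ_leq (maxn Q0 (size v)).
have [W [B [C le_W HC base]]] := return_base HL nq.
have le_v : (size v <= size W)%N by lia.
have lt_Q0 : (Q0 < (size W).+1)%N by lia.
have [N HN] := language_split C.
pose x := block_occurrences W B v.
pose S0 : rat := 2 * det_blocks x B +
  (40 * K)%:R * (det_blocks x B / (potential W B)%:R).
pose S1 : rat := S0 + (N + size W + max_block B).+1%:R.
have S1_ge0 : 0 <= S1.
  have d0 : 0 <= det_blocks x B / (potential W B)%:R by apply: divr_ge0; rewrite ?normr_ge0.
  by rewrite /S1; apply: addr_ge0; rewrite ?ler0n //; apply: addr_ge0; apply: mulr_ge0;
    rewrite ?normr_ge0 ?ler0n.
(* [N.+1] covers the words shorter than [N]; for the others both deviations are at most [S1]. *)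
exists (N.+1 + Num.bound (2 * S1))%N => w w' Lw Lw' sww'.
have [lt_N|le_N] := ltnP (size w) N.
  by have := occurrences_leq v w; lia.
have [rho sgn Hrho] :=
  weight_bounded HL K_gt0 complexity_leq lt_Q0 base (size w) x C HC.
have dev y : L y -> size y = size w ->
    `|(occurrences v y)%:R - rho * (size y)%:R| <= S1.
  move=> Ly sy; apply: (occurrences_deviation C le_v) => //.
  - exact: (deviation_bounds C sgn).
  - move=> u; rewrite sy => le_u Yu; apply: le_trans (Hrho u le_u Yu) _.
    exact: disc_bound_uniform.
  - by apply: HN => //; rewrite sy.
have := dev w Lw erefl; have := dev w' Lw' (esym sww'); rewrite -sww' !ler_norml.
move=> /andP[h1 h2] /andP[h3 h4].
have bnd : 2 * S1 < (Num.bound (2 * S1))%:R by rewrite archi_boundP // mulr_ge0.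
move: h1 h2 h3 h4; move: (occurrences v w) (occurrences v w') => n n' h1 h2 h3 h4.
suff : n%:R <= (n' + (N.+1 + Num.bound (2 * S1)))%:R :> rat.
  by rewrite ler_nat.
rewrite !natrD; have := ler0n rat N.+1; lra.
Qed.
End Balance.

(** * Minimal subshifts *)

Local Open Scope classical_set_scope.
Local Open Scope ring_scope.

Section Subshift.
Context (A : finType) (X : set (full_shift A)).
Implicit Types (x y : full_shift A) (i k : int) (u v w : seq A).

Definition translate k x : full_shift A := fun n : int => x (n + k).

Lemma size_subword x i q : size (subword x i q) = q.
Proof. by rewrite size_mkseq. Qed.

Lemma subword_cat x i p q :
  subword x i (p + q) = subword x i p ++ subword x (i + p%:Z) q.
Proof.
rewrite /subword /mkseq iotaD map_cat add0n; congr (_ ++ _).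
rewrite -{1}[p]addn0 iotaDl -map_comp; apply: eq_map => n /=.
by rewrite PoszD addrA.
Qed.

Lemma subword_translate x i k q : subword (translate k x) i q = subword x (i + k) q.
Proof. by apply: eq_map => n; rewrite /translate addrAC. Qed.

Lemma language_subword x i q : X x -> language X (subword x i q).
Proof. by move=> Xx; exists x => //; exists i; rewrite size_subword. Qed.

Lemma subword_infix x i q u v w : subword x i q = u ++ v ++ w ->
  v = subword x (i + (size u)%:Z) (size v).
Proof.
move=> e; have /esym := e; have := congr1 size e.
rewrite size_subword !size_cat => ->; rewrite !subword_cat => /eqP.
rewrite eqseq_cat ?size_subword // => /andP[_].
by rewrite eqseq_cat ?size_subword // => /andP[/eqP].
Qed.

Section Invariant.
Context (X_subshift : subshift X).

Lemma translate_nat x (n : nat) : X x -> X (translate n%:Z x).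
Proof.
have [_ XE] := X_subshift; elim: n => [|n IHn] Xx.
  rewrite (_ : translate _ _ = x) //; apply/funext => i.
  by rewrite /translate addr0.
rewrite -XE; exists (translate n%:Z x); first exact: IHn.
apply/funext => i; change (x (i + 1 + n%:Z) = x (i + n.+1%:Z)).
by rewrite -addrA -intS.
Qed.

Lemma translate_opp x (n : nat) : X x -> X (translate (- n%:Z) x).
Proof.
have [_ XE] := X_subshift; elim: n => [|n IHn] Xx.
  rewrite (_ : translate _ _ = x) //; apply/funext => i.
  by rewrite /translate oppr0 addr0.
have := IHn Xx; rewrite -{1}XE => -[y Xy ey].
rewrite (_ : translate _ _ = y) //; apply/funext => i.
have : y (i - 1 + 1) = x (i - 1 - n%:Z) := congr1 (fun z : full_shift A => z (i - 1)) ey.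
rewrite subrK => ->; change (x (i - n.+1%:Z) = x (i - 1 - n%:Z)).
by rewrite intS opprD addrA.
Qed.

Lemma translate_subshift x k : X x -> X (translate k x).
Proof.
move=> Xx; case: k => n; first exact: translate_nat.
by rewrite NegzE; apply: translate_opp.
Qed.

Lemma language_infix u v w : language X (u ++ v ++ w) -> language X v.
Proof.
by move=> [x Xx [i /esym/subword_infix ->]]; apply: language_subword.
Qed.

Lemma language_right u : language X u -> exists a, language X (rcons u a).
Proof.
move=> [x Xx [i eu]]; exists (x (i + (size u)%:Z)).
have -> : rcons u (x (i + (size u)%:Z)) = subword x i (size u + 1).
  by rewrite subword_cat -eu cats1 /subword /mkseq /= addr0.
exact: language_subword.
Qed.

Lemma language_left u : language X u -> exists a, language X (a :: u).
Proof.
move=> [x Xx [i eu]]; exists (x (i - 1)).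
have -> : x (i - 1) :: u = subword x (i - 1) (1 + size u).
  by rewrite subword_cat /= subrK -eu /subword /mkseq /= addr0.
exact: language_subword.
Qed.

Lemma closed_avoid i v : closed [set x : full_shift A | subword x i (size v) <> v].
Proof.
elim: v i => [|a v IHv] i.
  by rewrite (_ : [set _ | _] = set0); [exact: closed0 | apply/seteqP; split].
have -> : [set x : full_shift A | subword x i (size (a :: v)) <> a :: v] =
    [set x : full_shift A | x i <> a] `|`
    [set x : full_shift A | subword x (i + 1) (size v) <> v].
  apply/seteqP; split => x /=; rewrite -add1n subword_cat /subword /mkseq /= addr0.
    move=> ne; apply: contrapT => /not_orP[/contrapT e1 /contrapT e2].
    by apply: ne; rewrite e1 e2.
  by case=> ne [e1 e2]; apply: ne.
apply: closedU; last exact: IHv.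
have pc : continuous (proj i : full_shift A -> discrete_topology A).
  exact: proj_continuous.
by move/continuous_closedP: pc => /(_ [set b | b <> a]); apply; apply: discrete_closed.
Qed.

Lemma compact_subshift : compact X.
Proof.
have [cX _] := X_subshift.
apply: (subclosed_compact cX
  (B := [set x : full_shift A | forall i, [set: discrete_topology A] (x i)])) => //.
apply: (@tychonoff int (fun _ => discrete_topology A) (fun _ => setT)) => i.
by apply: finite_compact; apply: (@finite_finset A).
Qed.
End Invariant.

Section Minimal.
Context (X_minimal : minimal_subshift X).

Let X_subshift : subshift X. Proof. by case: X_minimal. Qed.

(** If long words avoid [v], some points of [X] avoid it on larger and larger windows. By
    compactness some point avoids it everywhere; such points form a nonempty subshift, which
    minimality makes all of [X]. *)
Lemma language_recurrent v : language X v -> exists N : nat,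
  forall u, language X u -> (N <= size u)%N -> infix v u.
Proof.
move=> Lv; apply: contrapT => nN.
pose avoid (N : nat) := [set x | X x /\
  forall i : int, (`|i| <= N)%N -> subword x i (size v) <> v].
have avoid0 N : avoid N !=set0.
  apply: contrapT => noN; apply: nN; exists (N + N + size v)%N => u [x Xx [j eu]] le_u.
  apply: contrapT => nvu; apply: noN; exists (translate (j + N%:Z) x); split.
    exact: translate_subshift.
  move=> i le_i; rewrite subword_translate => ev; apply: nvu; apply/infixP.
  have [n en] : exists n : nat, i + N%:Z = n%:Z by exists `|(i + N%:Z)%R|%N; lia.
  have [r er] : exists r, size u = (n + (size v + r))%N.
    by exists (size u - (n + size v))%N; lia.
  exists (subword x j n), (subword x (j + n%:Z + (size v)%:Z) r).
  rewrite {1}eu er !subword_cat -en.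
  by rewrite (_ : j + (i + N%:Z) = i + (j + N%:Z)) ?ev // addrCA.
have avoid_sub M N : (M <= N)%N -> avoid N `<=` avoid M.
  by move=> le_MN x [Xx Nx]; split=> // i le_i; apply: Nx; apply: leq_trans le_MN.
pose F := filter_from [set: nat] avoid.
have FF : ProperFilter F.
  apply: filter_from_proper => //; apply: filter_from_filter; first by exists 0%N.
  move=> M N _ _; exists (maxn M N) => //; rewrite subsetI.
  by split; apply: avoid_sub; rewrite ?leq_maxl ?leq_maxr.
have FX : F X by exists 0%N => // x [].
have [x [Xx]] := compact_subshift X_subshift FF FX.
rewrite clusterE => cx.
pose Y := [set y | X y /\ forall i, subword y i (size v) <> v].
have Yx : Y x.
  split=> // i; have := cx [set y | subword y i (size v) <> v].
  rewrite -(closure_id _).1; last exact: closed_avoid.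
  by apply; exists `|i|%N => // y [_]; apply.
have YX : Y = X.
  case: X_minimal => _ _; apply; [|by exists x|by move=> y []].
  have [cX XE] := X_subshift; split.
    have -> : Y = X `&` \bigcap_(i in [set: int]) [set y | subword y i (size v) <> v].
      by apply/seteqP; split=> [y [Xy Hy]|y [Xy Hy]]; split=> // i; [move=> _|]; apply: Hy.
    apply: closedI => //; apply: closed_bigI => i _; exact: closed_avoid.
  apply/seteqP; split=> [_ [y [Xy Hy] <-]|y [Xy Hy]].
    split=> [|i]; first by rewrite -XE; exists y.
    by have := Hy (i + 1); rewrite -subword_translate.
  exists (translate (- 1) y).
    split=> [|i]; first exact: translate_subshift.
    by rewrite subword_translate.
  by apply/funext => i; change (y (i + 1 - 1) = y i); rewrite addrK.
have [y Xy [i ey]] := Lv; move: Xy; rewrite -YX => -[_ /(_ i)].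
by rewrite -ey.
Qed.
End Minimal.

(** Stated for all larger windows, so that a single window separates finitely many points. *)
Lemma separating_window x y : exists N, forall M, (N <= M)%N ->
  subword x (- M%:Z) (M + M).+1 = subword y (- M%:Z) (M + M).+1 -> x = y.
Proof.
have [->|xy] := pselect (x = y); first by exists 0%N.
have [j xyj] : exists j, x j <> y j.
  apply: contrapT => no; apply: xy; apply/funext => j; apply: contrapT => ne.
  by apply: no; exists j.
exists `|j|%N => M le_j e; case: xyj.
have jM : (`|(j + M%:Z)%R| < (M + M).+1)%N by lia.
have := congr1 (fun s => nth (x 0) s `|(j + M%:Z)%R|) e.
rewrite !nth_mkseq // (_ : - M%:Z + _ = j) //; lia.
Qed.

Lemma nwords_unbounded : infinite_set X -> forall n q, exists2 q', (q <= q')%N &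
  (n <= nwords (language X) q')%N.
Proof.
move=> /infinite_set_fsetP X_inf n q; have [S SX le_n] := X_inf n.
set s := finmap.enum_fset S in le_n.
have sX x : x \in s -> X x by move=> xs; apply: SX.
have us : uniq s by apply: finmap.fset_uniq.
pose N x y := projT1 (cid (separating_window x y)).
pose M := maxn q (\max_(x <- s) \max_(y <- s) N x y).
have sep x y : x \in s -> y \in s ->
    subword x (- M%:Z) (M + M).+1 = subword y (- M%:Z) (M + M).+1 -> x = y.
  move=> xs ys; apply: (projT2 (cid (separating_window x y))).
  rewrite leq_max; apply/orP; right.
  by apply: (bigmaxn_sup_seq x) => //; apply: (bigmaxn_sup_seq y).
exists (M + M).+1; first by rewrite /M; lia.
apply: leq_trans le_n _.
have sz x : size (subword x (- M%:Z) (M + M).+1) == (M + M).+1 by rewrite size_subword.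
pose W x : (M + M).+1.-tuple A := Tuple (sz x).
have uW : uniq (map W s) by rewrite map_inj_in_uniq // => x y xs ys /(congr1 val); exact: sep.
rewrite -(size_map W) -(card_uniqP uW); apply: subset_leq_card.
apply/fintype.subsetP => w /mapP[x xs ->]; rewrite inE; apply/asboolP.
by apply: language_subword; apply: sX.
Qed.

(** Morse-Hedlund argument: without right special words of length [q] there are no longer ones, so
    the complexity stops growing, against [nwords_unbounded]. *)
Lemma language_special (X_subshift : subshift X) : infinite_set X -> forall q,
  exists2 z, size z = q & right_special (language X) z.
Proof.
move=> X_inf q; apply: contrapT => noq.
have noq' q' z : (q <= q')%N -> size z = q' -> ~ right_special (language X) z.
  move=> le_q sz [a [b [ab La Lb]]]; apply: noq; exists (drop (q' - q) z).
    by rewrite size_drop sz subKn.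
  exists a, b; split=> //; apply: (@language_infix (take (q' - q) z) _ [::]);
    by rewrite cats0 -rcons_cat cat_take_drop.
have step q' : (q <= q')%N -> (nwords (language X) q'.+1 <= nwords (language X) q')%N.
  move=> le_q; pose tk (t : q'.+1.-tuple A) : q'.-tuple A := Tuple (size_take_tuple t).
  have tk_inj : {in [set t : q'.+1.-tuple A | `[< language X t >]]%SET &, injective tk}.
    move=> t t'; rewrite !inE => /asboolP Lt /asboolP Lt' /(congr1 val) /= ett'.
    apply: val_inj => /=; have := size_tuple t; have := size_tuple t'.
    case/lastP: (tval t) Lt ett' => // z a La; case/lastP: (tval t') Lt' => // z' b Lb.
    rewrite -!cats1 => + sz' sz; rewrite !size_cat !addn1 in sz sz'.
    move: sz sz' => [sz] [sz']; rewrite !take_size_cat // => ez.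
    rewrite -ez in Lb *; congr (_ ++ [:: _]); apply: contrapT => ab.
    apply: (noq' q' z le_q sz); exists a, b.
    by split; [exact/eqP | exact/asboolP | exact/asboolP].
  rewrite /nwords -(card_in_imset tk_inj); apply: subset_leq_card.
  apply/fintype.subsetP => w /imsetP[t]; rewrite !inE => /asboolP Lt ->; apply/asboolP => /=.
  move: Lt => /asboolP Lt; apply/asboolP.
  by apply: (@language_infix [::] _ (drop q' t)); rewrite cat_take_drop.
have bounded n : (nwords (language X) (q + n) <= nwords (language X) q)%N.
  elim: n => [|n IHn]; first by rewrite addn0.
  by rewrite addnS (leq_trans (step _ _)) // leq_addr.
have [q' le_q] := nwords_unbounded X_inf (nwords (language X) q).+1 q.
by rewrite leqNgt ltnS -(subnKC le_q) bounded.
Qed.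
End Subshift.

(** The room below 3/2 is expressed in natural numbers: [K q / (2 K + 1)] is smaller than [q / 2] by
    a fixed proportion. *)
Lemma limn_esup_ratio_lt (R : realType) (p : nat -> nat) :
  (limn_esup (fun q => ((p q)%:R / q%:R : R)%:E) < (3 / 2 : R)%:E)%E ->
  exists K Q0 : nat, (0 < K)%N /\ forall q m, (Q0 <= q)%N -> (q + m <= p q.+1)%N ->
    (K.*2.+1 * m <= K * q)%N.
Proof.
move=> /ereal_inf_lt[_ [V [N _ NV] <-] sup_lt].
set u := fun q : nat => _ in sup_lt.
have [c [lt_c uc]] : exists c : R, c < 3 / 2 /\ forall q, (N <= q)%N -> (p q)%:R / q%:R <= c.
  have le_sup q : (N <= q)%N -> (u q <= ereal_sup [set u x | x in V])%E.
    by move=> le_q; apply: ereal_sup_ubound; exists q => //; apply: NV.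
  case: (ereal_sup _) sup_lt le_sup => [c||] // lt_c le_c.
    by exists c; split=> // q /le_c.
  by have := le_c N (leqnn N).
pose d := 3 / 2 - c; have d0 : 0 < d by rewrite subr_gt0.
(* [K d >= 1] gives [(2 K + 1) (1 - d) <= 2 K]; [q d >= 3] absorbs the constant that comes from
   evaluating at [q.+1]. *)
pose K := (Num.bound d^-1).+1; pose Q0 := maxn N (Num.bound (3 / d)).
have Kd : 1 <= K%:R * d.
  rewrite -ler_pdivrMr // mul1r ltW //; apply: lt_trans (archi_boundP _) _.
    by rewrite invr_ge0 ltW.
  by rewrite ltr_nat.
exists K, Q0; split=> // q m le_q le_p.
have qd : 3 <= q%:R * d.
  rewrite -ler_pdivrMr // ltW //; apply: lt_le_trans (archi_boundP _) _.
    by rewrite divr_ge0 // ltW.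
  by rewrite ler_nat; exact: leq_trans (leq_maxr _ _) le_q.
have le_N : (N <= q.+1)%N by exact: leqW (leq_trans (leq_maxl _ _) le_q).
have := uc q.+1 le_N; rewrite ler_pdivrMr ?ltr0n // -natr1 => le_pc.
have {}le_p : q%:R + m%:R <= (p q.+1)%:R :> R by rewrite -natrD ler_nat.
have le_m : 2 * m%:R <= (1 - d) * q%:R by rewrite /d in d0 qd *; lra.
rewrite -(ler_nat R) !natrM -natr1 -mul2n natrM.
have q0 : 0 <= q%:R :> R by [].
have h1 := ler_wpM2r q0 Kd; have h2 : 0 <= d * q%:R by rewrite mulr_ge0 // ltW.
have K1 : 0 <= 2 * K%:R + 1 :> R by rewrite addr_ge0 // mulr_ge0.
have := ler_wpM2l K1 le_m; lra.
Qed.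

Unset Implicit Arguments.

(* The value of the quotient at q = 0 does not affect the limsup. *)
Theorem theorem7p1 (R : realType) (A : finType) (X : set (full_shift A))
    (X_minimal : minimal_subshift X) (X_infinite : infinite_set X)
    (X_complexity :
      (limn_esup (fun q : nat => ((complexity X q)%:R / q%:R : R)%:E)
         < (3 / 2 : R)%:E)%E) :
  balanced_on_words X.
Proof.
have [K [Q0 [K_gt0 HK]]] := limn_esup_ratio_lt X_complexity.
have [X_subshift _ _] := X_minimal.
have HL : recurrent_language (language X).
  split; [exact: language_infix | exact: language_right | exact: language_left | |].
    exact: language_recurrent.
  exact: language_special.
move=> v _; have [C HC] := low_complexity_balanced HL K_gt0 HK v.
exists C.+1%:Z => // w w' Lw Lw' sww'.
have := HC w w' Lw Lw' sww'; have := HC w' w Lw' Lw (esym sww'); lia.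
Qed.
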